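(* Let $d\geq 2$ be an integer and let $\mathbb{T}_d$ be the infinite $d$--regular tree. Then: (a) for $t\geq 0$, $$p(\mathbb{T}_d,t)=\frac{2d^2t+d-d\sqrt{1+4(d-1)t}}{2d^2t+2};$$ (b) for $t>0$, $$\int \frac{1}{2}\ln(1+tz^2)\,d\rho_{\mathbb{T}_d}(z)=\frac{1}{2}\ln S_d(t),\quad\text{where } S_d(t)=\frac{1}{\eta_t^2}\left(\frac{d-1}{d-\eta_t}\right)^{d-2},\ \ \eta_t=\frac{\sqrt{1+4(d-1)t}-1}{2(d-1)t};$$ (c) for $0\leq p<1$, $$t(\mathbb{T}_d,p)=\frac{p(d-p)}{d^2(1-p)^2};$$ (d) for $0\leq p\leq 1$, $$\lambda_{\mathbb{T}_d}(p)=\frac{1}{2}\left(p\ln\left(\frac{d}{p}\right)+(d-p)\ln\left(1-\frac{p}{d}\right)-2(1-p)\ln(1-p)\right).$$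
   Context: For a finite graph $G$ with $m_k(G)$ matchings of size $k$ ($m_0=1$), let $M(G,t)=\sum_k m_k(G)t^k$, $p(G,t)=\frac{2t\,\frac{d}{dt}M(G,t)}{v(G)M(G,t)}$ for $t\geq0$. Let $\nu(G)$ be the maximum matching size and $p^*(G)=2\nu(G)/v(G)$; $p(G,\cdot)$ is a strictly increasing bijection $[0,\infty)\to[0,p^*(G))$, with inverse $t(G,p)$. For $0\leq p<p^*(G)$ let $\lambda_G(p)=\frac{\ln M(G,t(G,p))}{v(G)}-\frac12 p\ln t(G,p)$ (with value $0$ at $p=0$), $\lambda_G(p^* )=\lim_{p\nearrow p^*}\lambda_G(p)$, and $\lambda_G(p)=0$ for $p>p^*$. The matching polynomial is $\mu(G,x)=\sum_k(-1)^km_k(G)x^{v(G)-2k}$ and the matching measure $\rho_G$ is the uniform probability measure on its zeros counted with multiplicity. Let $(G_i)$ be any sequence of finite $d$--regular bipartite graphs whose girth (length of shortest cycle) tends to infinity. Then the following limits exist and do not depend on the choice of the sequence, and serve as definitions: $p(\mathbb{T}_d,t)=\lim_i p(G_i,t)$ ($t\geq0$); $t(\mathbb{T}_d,p)=\lim_i t(G_i,p)$ and $\lambda_{\mathbb{T}_d}(p)=\lim_i\lambda_{G_i}(p)$ ($0\leq p<1$); $\lambda_{\mathbb{T}_d}(1)=\lim_{p\nearrow1}\lambda_{\mathbb{T}_d}(p)$; and $\rho_{\mathbb{T}_d}$ is the weak limit of $\rho_{G_i}$. Convention $0\ln(\cdot)=0$. *)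

(* Defs.v *)
From HB Require Import structures.
From mathcomp Require Import all_boot all_order all_algebra.
From mathcomp Require Import all_classical all_reals all_analysis.
Set Implicit Arguments. Unset Strict Implicit. Unset Printing Implicit Defensive.
Import Order.TTheory GRing.Theory Num.Theory.
Import numFieldNormedType.Exports.
Local Open Scope ring_scope.

Record graph := Graph {
  gv : nat;
  gadj : rel 'I_gv;
  gadj_sym : symmetric gadj;
  gadj_irr : irreflexive gadj }.

Definition is_matching (G : graph) (M : {set {set 'I_(gv G)}}) : bool :=
  [forall E in M, exists x : 'I_(gv G), exists y : 'I_(gv G),
     @gadj G x y && (E == [set x; y])] &&
  [forall E in M, forall F in M, (E != F) ==> [disjoint E & F]].

Definition mk (G : graph) (k : nat) : nat :=
  #|[set M : {set {set 'I_(gv G)}} | is_matching M && (#|M| == k)]|.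

Definition nu (G : graph) : nat :=
  \max_(M : {set {set 'I_(gv G)}} | is_matching M) #|M|.

Section Real.
Variable R : realType.

Definition Mpoly (G : graph) : {poly R} :=
  \sum_(k < (gv G).+1) (mk G k)%:R *: 'X^k.

Definition pG (G : graph) (t : R) : R :=
  2 * t * (Mpoly G)^`().[t] / ((gv G)%:R * (Mpoly G).[t]).

Definition pstar (G : graph) : R := 2 * (nu G)%:R / (gv G)%:R.

(* t(G,p): the inverse of p(G,.) on [0,p^*(G)) *)
Definition tG (G : graph) (p : R) : R :=
  xget 0 (fun t : R => 0 <= t /\ pG G t = p).

Definition lambda0 (G : graph) (p : R) : R :=
  ln (Mpoly G).[tG G p] / (gv G)%:R - 2^-1 * p * ln (tG G p).

Local Open Scope classical_set_scope.

Definition lambdaG (G : graph) (p : R) : R :=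
  if p == 0 then 0
  else if p < pstar G then lambda0 G p
  else if p == pstar G then lim (lambda0 G x @[x --> (pstar G)^'-])
  else 0.

Definition mupoly (G : graph) : {poly R} :=
  \sum_(k < (gv G).+1) ((-1) ^+ k * (mk G k)%:R) *: 'X^(gv G - 2 * k).

(* the zeros of mu(G,.) listed with multiplicity (they are all real) *)
Definition mroots (G : graph) : seq R :=
  xget [::] (fun s : seq R => mupoly G = \prod_(z <- s) ('X - z%:P)).

(* integral of f against the matching measure rho_G (uniform probability
   measure on the zeros, counted with multiplicity) *)
Definition rho_int (G : graph) (f : R -> R) : R :=
  (\sum_(z <- mroots G) f z) / (gv G)%:R.

Definition weak_limit (Gs : nat -> graph) (rho : probability R R) : Prop :=
  forall f : R -> R, continuous f -> (exists M : R, forall x, `|f x| <= M) ->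
    (rho_int (Gs i) f)%:E @[i --> \oo] --> (\int[rho]_x (f x)%:E)%E.

Definition eta (d : nat) (t : R) : R :=
  (Num.sqrt (1 + 4 * (d%:R - 1) * t) - 1) / (2 * (d%:R - 1) * t).
Definition Sd (d : nat) (t : R) : R :=
  (eta d t ^+ 2)^-1 * ((d%:R - 1) / (d%:R - eta d t)) ^+ (d - 2).
Definition lambdaT (d : nat) (p : R) : R :=
  2^-1 * (p * ln (d%:R / p) + (d%:R - p) * ln (1 - p / d%:R)
          - 2 * (1 - p) * ln (1 - p)).

End Real.

Local Open Scope classical_set_scope.

Definition regular (d : nat) (G : graph) : Prop :=
  forall x : 'I_(gv G), #|[set y | @gadj G x y]%SET| = d.

Definition bipartite (G : graph) : Prop :=
  exists c : 'I_(gv G) -> bool, forall x y, @gadj G x y -> c x != c y.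

Definition is_cycle (G : graph) (s : seq 'I_(gv G)) : bool :=
  [&& (3 <= size s)%N, uniq s & cycle (@gadj G) s].

Definition girth_to_infty (Gs : nat -> graph) : Prop :=
  forall L : nat, \forall i \near \oo,
    forall s : seq 'I_(gv (Gs i)), is_cycle s -> (L < size s)%N.

(* Main.v *)
(* Fix t and delete vertices one at a time: the probability that v is left
   uncovered by a random matching of G[W] weighted by t^|M| is
   r(W,v) = Z(W - v)/Z(W) = 1/(1 + t sum r(W - v, u)), u running over the
   neighbours of v still in W.  Along a path without short cycle each vertex
   keeps exactly d - 1 free neighbours, and one step of the recursion contracts
   the ratio to the fixed point eta = 1/(1 + (d - 1) t eta) by the factor
   s/(1 + s), s = (d - 1) t, so p(G,t) is exponentially close in the girth to
   its limit.  In the variable eta this limit and ln M(G,t)/v(G) are elementary,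
   and the mean value theorem on [eta, 1] (t = 0 is eta = 1) transfers the bound
   from p(G,t), which is 2t times the derivative of ln M(G,t)/v(G), to
   ln M(G,t)/v(G) itself.  Monotonicity of p(G,.) then gives t(G,p) and lambda.
   For the measure, M(G,t)^2 = prod (1 + t z^2) over the zeros z of mu(G,.), and
   the same recursion at small negative t bounds these zeros by z^2 <= 4d. *)
From Pilot Require Import Defs.
From HB Require Import structures.
From mathcomp Require Import all_boot all_order all_algebra.
From mathcomp Require Import all_classical all_reals all_analysis.
From mathcomp Require Import measurable_realfun.
From mathcomp Require Import zify ring lra.
Import Order.TTheory GRing.Theory Num.Theory.
Import numFieldNormedType.Exports.
Local Open Scope ring_scope.
Set Implicit Arguments. Unset Strict Implicit. Unset Printing Implicit Defensive.

(** * Matchings and the vertex-deletion recursion *)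

Section Matchings.
(* [all_classical] shadows the names of [finset]. *)
Import boot.fintype boot.finset.
Variable G : graph.
Local Notation V := 'I_(gv G).
Implicit Types (M : {set {set V}}) (W : {set V}) (u v : V).

Lemma matchingP M :
  reflect ((forall E, E \in M -> exists x y, @gadj G x y /\ E = [set x; y]) /\
           (forall E F, E \in M -> F \in M -> E != F -> [disjoint E & F]))
          (is_matching M).
Proof.
apply: (iffP andP) => -[h1 h2]; split.
- move=> E EM; move/forallP: h1 => /(_ E)/implyP/(_ EM)/existsP[x /existsP[y]].
  by case/andP=> a /eqP e; exists x, y.
- move=> E F EM FM; move/forallP: h2 => /(_ E)/implyP/(_ EM)/forallP/(_ F).
  by move=> /implyP/(_ FM)/implyP.
- apply/forallP => E; apply/implyP => /h1 [x [y [a e]]].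
  by apply/existsP; exists x; apply/existsP; exists y; rewrite a e eqxx.
- apply/forallP => E; apply/implyP => EM; apply/forallP => F; apply/implyP => FM.
  by apply/implyP => /h2; apply.
Qed.

Lemma gadj_neq u v : @gadj G u v -> u != v.
Proof. by apply: contraTneq => ->; rewrite gadj_irr. Qed.

Lemma matching_card_cover M : is_matching M -> #|cover M| = (2 * #|M|)%N.
Proof.
move=> /matchingP[h1 h2].
have /eqP <- : trivIset M by apply/trivIsetP => E F; exact: h2.
rewrite (eq_bigr (fun=> 2%N)); first by rewrite sum_nat_const mulnC.
by move=> E /h1[x [y [/gadj_neq a ->]]]; rewrite cards2 a.
Qed.

Lemma matching_size M : is_matching M -> (2 * #|M| <= gv G)%N.
Proof.
by move=> /matching_card_cover <-; rewrite -[X in (_ <= X)%N]card_ord max_card.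
Qed.

Lemma is_matching0 : is_matching (set0 : {set {set V}}).
Proof. by apply/matchingP; split => E; rewrite inE. Qed.

Lemma matching_sub M M' : M' \subset M -> is_matching M -> is_matching M'.
Proof.
move=> /subsetP s /matchingP[h1 h2]; apply/matchingP; split.
  by move=> E /s /h1.
by move=> E F /s EM /s FM; exact: h2.
Qed.

Lemma matching_partner M u u' v : is_matching M ->
  [set v; u] \in M -> [set v; u'] \in M -> u' = u.
Proof.
move=> mM hu hu'; have /matchingP[h1 h2] := mM.
have e : [set v; u] = [set v; u'].
  apply/eqP; apply/negPn/negP => ne; have := h2 _ _ hu hu' ne.
  by move/pred0P => /(_ v) /=; rewrite !inE eqxx.
have : u' \in [set v; u] by rewrite e !inE eqxx orbT.
rewrite !inE => /orP[/eqP uv|/eqP//].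
(* The remaining case [u' = v] would make the edge a singleton. *)
have [x [y [/gadj_neq xy exy]]] := h1 _ hu'.
by have := cards2 x y; rewrite -exy uv xy cards2 eqxx.
Qed.

Lemma matching_adj M u v : is_matching M -> [set v; u] \in M -> @gadj G v u.
Proof.
move=> /matchingP[h1 _] /h1 [x [y [a e]]].
have : v \in [set x; y] by rewrite -e !inE eqxx.
have : u \in [set x; y] by rewrite -e !inE eqxx orbT.
have xy := gadj_neq a.
have c : #|[set v; u]| = 2%N by rewrite e cards2 xy.
have vu : v != u by move: c; rewrite cards2; case: (v != u).
rewrite !inE => /orP[]/eqP eu /orP[]/eqP ev; subst => //.
- by rewrite eqxx in vu.
- by rewrite gadj_sym.
- by rewrite eqxx in vu.
Qed.

Lemma matching_coverP M v : is_matching M ->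
  reflect (exists u, [set v; u] \in M) (v \in cover M).
Proof.
move=> /matchingP[h1 h2]; apply: (iffP bigcupP) => [[E EM]|[u hu]]; last first.
  by exists [set v; u] => //; rewrite !inE eqxx.
have [x [y [a e]]] := h1 _ EM; subst E.
rewrite !inE => /orP[]/eqP ->; first by exists y.
by exists x; rewrite setUC.
Qed.

Lemma matchingU1 M u v : @gadj G v u -> is_matching M ->
  v \notin cover M -> u \notin cover M -> is_matching ([set v; u] |: M).
Proof.
move=> a mM hv hu; have /matchingP[h1 h2] := mM; apply/matchingP.
have dis E : E \in M -> [disjoint [set v; u] & E].
  move=> EM; apply/pred0P => x /=; rewrite !inE.
  apply/negbTE/negP => /andP[/orP[]/eqP -> xE].
    by case/negP: hv; apply/bigcupP; exists E.
  by case/negP: hu; apply/bigcupP; exists E.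
split=> [E|E F].
  by rewrite !inE => /orP[/eqP ->|/h1//]; exists v, u.
rewrite !inE => /orP[/eqP ->|EM] /orP[/eqP ->|FM]; rewrite ?eqxx //.
- by move=> _; exact: dis.
- by move=> _; rewrite disjoint_sym; exact: dis.
- exact: h2.
Qed.

Lemma cover_setU1 M (E : {set V}) : cover (E |: M) = (E :|: cover M).
Proof.
apply/setP => x; rewrite !inE; apply/bigcupP/orP => [[F]|[xE|/bigcupP[F FM xF]]].
- rewrite !inE => /orP[/eqP ->|FM xF]; first by left.
  by right; apply/bigcupP; exists F.
- by exists E => //; rewrite !inE eqxx.
- by exists F => //; rewrite !inE FM orbT.
Qed.

Variable R : realType.
Implicit Type t : R.

(** The matching generating function of the induced subgraph on [W], taken over matchings of [G]
    covered by [W], so that deleting a vertex is a set difference and no subgraph is built. *)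
Definition Zm W t : R :=
  \sum_(M : {set {set V}} | is_matching M && (cover M \subset W)) t ^+ #|M|.

Lemma Zm_gt0 W t : 0 <= t -> 0 < Zm W t.
Proof.
move=> t0; rewrite /Zm (bigD1 set0) /=; last first.
  by rewrite is_matching0 /cover big_set0 sub0set.
rewrite cards0 expr0 ltr_pwDl// sumr_ge0// => M _; exact: exprn_ge0.
Qed.

Lemma Zm_at0 W : Zm W 0 = 1.
Proof.
rewrite /Zm (bigD1 set0) /=; last first.
  by rewrite is_matching0 /cover big_set0 sub0set.
rewrite cards0 expr0 big1 ?addr0// => M /andP[_ M0].
by rewrite expr0n cards_eq0 (negbTE M0).
Qed.

(** Nothing is cut off at [gv G], since a matching has at most half as many edges. Serves for
    [Mpoly], its derivative and the signed polynomial alike. *)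
Lemma sum_mk (g : nat -> R) :
  \sum_(k < (gv G).+1) (mk G k)%:R * g k =
  \sum_(M : {set {set V}} | is_matching M) g #|M|.
Proof.
have lt M : is_matching M -> (#|M| < (gv G).+1)%N.
  by move=> /matching_size; rewrite ltnS; apply: leq_trans; rewrite mul2n -addnn leq_addr.
rewrite [RHS](partition_big (fun M => inord #|M| : 'I_(gv G).+1) xpredT) //=.
apply: eq_bigr => k _.
rewrite (eq_bigr (fun=> g k)); last first.
  by move=> M /andP[mM /eqP <-]; rewrite inordK ?lt.
rewrite sumr_const mulr_natl /mk; congr (_ *+ _).
rewrite cardsE; apply: eq_card => M; rewrite /in_mem /= /in_mem /=.
by case: (boolP (is_matching M)) => //= mM; rewrite -val_eqE /= inordK// lt.
Qed.

Lemma Mpoly_horner t : (Mpoly R G).[t] = Zm [set: V] t.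
Proof.
rewrite /Mpoly horner_sum.
under eq_bigr do rewrite hornerZ hornerXn.
by rewrite (sum_mk (fun k => t ^+ k)); apply: eq_bigl => M; rewrite subsetT andbT.
Qed.

(** A matching that covers [v] is one edge from [v] to some [u] together with a matching that avoids
    both ends. *)
Lemma Zm_rec W v t : v \in W ->
  Zm W t = Zm (W :\ v) t + t * \sum_(u in (W :\ v) | @gadj G v u) Zm (W :\ v :\ u) t.
Proof.
move=> vW; rewrite {1}/Zm (bigID (fun M => v \in cover M)) /= addrC; congr (_ + _).
  by apply: eq_bigl => M; rewrite subsetD1 andbA.
(* The inner sum has exactly one term, the partner of [v]; it prepares the exchange of the two
   sums. *)
rewrite (eq_bigr (fun M => \sum_(u : V | [set v; u] \in M) t ^+ #|M|)); last first.
  move=> M /andP[/andP[mM _] /(matching_coverP _ mM) [u hu]].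
  rewrite (big_pred1 u)// => u'; apply/idP/eqP => [|-> //].
  exact: matching_partner.
rewrite (exchange_big_dep (fun u => (u \in (W :\ v)) && @gadj G v u)) /=; last first.
  move=> M u /andP[/andP[mM cW] _] hu; rewrite (matching_adj mM hu) andbT.
  have := gadj_neq (matching_adj mM hu); rewrite !inE eq_sym => -> /=.
  by apply: (subsetP cW); apply/bigcupP; exists [set v; u] => //; rewrite !inE eqxx orbT.
rewrite mulr_sumr; apply: eq_bigr => u /andP[uW vu].
(* Adding and removing the edge are mutually inverse; [key] identifies the matchings in range. *)
rewrite (reindex_onto (fun M => [set v; u] |: M) (fun M => M :\ [set v; u])) /=; last first.
  by move=> M /andP[_ hu]; exact: setD1K.
rewrite mulr_sumr.
have key M : (is_matching ([set v; u] |: M) &&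
     (cover ([set v; u] |: M) \subset W) &&
     (v \in cover ([set v; u] |: M)) &&
     ([set v; u] \in ([set v; u] |: M)) &&
     (([set v; u] |: M) :\ [set v; u] == M)) =
   (is_matching M && (cover M \subset W :\ v :\ u)).
  rewrite cover_setU1 !inE !eqxx /= !andbT.
  apply/idP/idP.
    case/andP => /andP[mM cW] /eqP eM.
    have nM : [set v; u] \notin M by rewrite -eM !inE eqxx.
    have mM' : is_matching M by apply: matching_sub mM; exact: subsetUr.
    rewrite mM' /= !subsetD1.
    have sW : cover M \subset W by apply: subset_trans cW; exact: subsetUr.
    rewrite sW /=; apply/andP; split; apply/negP => /(matching_coverP _ mM')[w hw].
      have hw' : [set v; w] \in ([set v; u] |: M) by rewrite !inE hw orbT.
      have hu' : [set v; u] \in ([set v; u] |: M) by rewrite !inE eqxx.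
      by case/negP: nM; rewrite -(matching_partner mM hu' hw').
    have hw' : [set u; w] \in ([set v; u] |: M) by rewrite !inE hw orbT.
    have hu' : [set u; v] \in ([set v; u] |: M).
      by rewrite !inE setUC eqxx.
    by case/negP: nM; rewrite setUC -(matching_partner mM hu' hw').
  case/andP => mM; rewrite !subsetD1 => /andP[/andP[cW hv] hu].
  rewrite matchingU1//= subUset cW andbT subUset !sub1set vW /=.
  move: uW; rewrite !inE => /andP[_ ->] /=.
  rewrite setU1K//; apply: contra hv => h; apply/bigcupP; exists [set v; u] => //.
  by rewrite !inE eqxx.
rewrite (eq_bigl _ _ key); apply: eq_bigr => M /andP[mM cW].
rewrite cardsU1 exprD; case: (boolP ([set v; u] \in M)) => [h|_]; last by rewrite expr1.
have : v \in cover M by apply/bigcupP; exists [set v; u] => //; rewrite !inE eqxx.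
by move/(subsetP cW); rewrite !inE eqxx /= andbF.
Qed.

Lemma Mpoly_deriv_sum t : 2 * t * (Mpoly R G)^`().[t] =
  \sum_(M : {set {set V}} | is_matching M) (2 * #|M|)%:R * t ^+ #|M|.
Proof.
rewrite -(sum_mk (fun k => (2 * k)%:R * t ^+ k)) /Mpoly raddf_sum horner_sum mulr_sumr.
apply: eq_bigr => k _; rewrite [X in X.[_]]derivZ derivXn hornerZ hornerMn hornerXn.
case: (k : nat) => [|m] /=; first by rewrite muln0 mulr0n mulr0 !mul0r !mulr0.
by rewrite -mulr_natr natrM exprS; ring.
Qed.

(** Double counting: [2 * #|M|] is the number of covered vertices, and subtracting [Zm ([set: V] :\
    v) t] leaves the matchings that cover [v]. *)
Lemma Mpoly_deriv t : 2 * t * (Mpoly R G)^`().[t] =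
  \sum_(v : V) (Zm [set: V] t - Zm ([set: V] :\ v) t).
Proof.
rewrite Mpoly_deriv_sum.
rewrite (eq_bigr (fun M => \sum_(v in cover M) t ^+ #|M|)); last first.
  by move=> M mM; rewrite sumr_const matching_card_cover// mulr_natl.
rewrite (exchange_big_dep xpredT) //=; apply: eq_bigr => v _.
rewrite {1}/Zm [in RHS](bigID (fun M => v \in cover M)) /= [X in _ = _ + X - _](_ : _ = Zm ([set: V] :\ v) t).
  by rewrite addrK; apply: eq_bigl => M; rewrite subsetT andbT.
by apply: eq_bigl => M; rewrite subsetD1 andbA.
Qed.

End Matchings.

(** * Contraction of the deletion ratios *)

(** A relative error [A - 1] in the sum shrinks by the factor [s / (1 + s)] once 1 is added: with
    [H = A * S] the gap is [(A - 1) * (s - S) / (1 + s)]. *)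
Lemma contraction_step (R : realFieldType) (s A S H : R) :
  0 <= s -> 1 <= A -> 0 <= S <= s -> H <= A * S ->
  1 + H <= (1 + s / (1 + s) * (A - 1)) * (1 + S).
Proof.
move=> s0 A1 /andP[S0 Ss] HAS; apply: (@le_trans _ _ (1 + A * S)); first by lra.
have s1 : 0 < 1 + s by lra.
rewrite -subr_ge0 (_ : _ - _ = (A - 1) * (s - S) / (1 + s)); last by field; lra.
by rewrite divr_ge0 ?mulr_ge0//; lra.
Qed.

Section Ratio.
Import boot.fintype boot.finset.
Variables (G : graph) (R : realType).
Local Notation V := 'I_(gv G).
Implicit Types (W : {set V}) (v : V) (t : R).

Definition vratio W v t : R := Zm (W :\ v) t / Zm W t.

Lemma vratio_rec W v t : v \in W -> Zm (W :\ v) t != 0 ->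
  vratio W v t = (1 + t * \sum_(u in (W :\ v) | @gadj G v u) vratio (W :\ v) u t)^-1.
Proof.
move=> vW nz; rewrite /vratio (Zm_rec t vW) -[LHS]invf_div mulrDl divff//.
by rewrite -mulrA mulr_suml.
Qed.

Lemma vratio_gt0 W v t : 0 <= t -> 0 < vratio W v t.
Proof. by move=> t0; rewrite /vratio divr_gt0// Zm_gt0. Qed.

Lemma vratio_le1 W v t : 0 <= t -> v \in W -> vratio W v t <= 1.
Proof.
move=> t0 vW; rewrite vratio_rec// ?gt_eqF ?Zm_gt0//.
have h : 0 <= t * \sum_(u in (W :\ v) | @gadj G v u) vratio (W :\ v) u t.
  by rewrite mulr_ge0// sumr_ge0// => u _; apply/ltW/vratio_gt0.
by rewrite invf_le1; lra.
Qed.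

Variables (d L : nat).
Hypothesis regG : regular d G.
Hypothesis girthG : forall s : seq V, is_cycle s -> (L < size s)%N.

(** Only [w] drops out among the neighbours of [v]: another neighbour on the path would close a
    cycle of length at most [size q + 2]. *)
Lemma card_free_neighbours v q w : path (@gadj G) v (w :: q) -> uniq (v :: w :: q) ->
  (size q + 2 <= L)%N ->
  #|[set u in ~: [set x in w :: q] :\ v | @gadj G v u]| = d.-1.
Proof.
move=> pq uq sq; have vw : @gadj G v w by move: pq => /= /andP[].
rewrite -(regG v) [in RHS](cardsD1 w) inE vw add1n /=.
apply: eq_card => u; rewrite !inE.
case: (boolP (@gadj G v u)) => vu; rewrite ?andbF ?andbT//.
have -> /= : u != v by rewrite eq_sym; exact: gadj_neq.
case: (eqVneq u w) => //= uw; apply/negP => uq'.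
(* The candidate cycle is [v] followed by the path from [w] up to [u]; its length is at least 3
   because [u] differs from [w]. *)
have := @girthG (v :: take (index u (w :: q)).+1 (w :: q)).
have hi : (index u (w :: q) < size (w :: q))%N by rewrite index_mem inE uq' orbT.
have sz : size (take (index u (w :: q)).+1 (w :: q)) = (index u (w :: q)).+1.
  by rewrite size_takel.
have i1 : (0 < index u (w :: q))%N by rewrite /= eq_sym (negbTE uw).
have uT : nth v (take (index u (w :: q)).+1 (w :: q)) (index u (w :: q)) = u.
  by rewrite nth_take// nth_index// inE uq' orbT.
have pT := take_path (index u (w :: q)).+1 pq.
have sT := @mem_take (index u (w :: q)).+1 _ (w :: q).
have unT : uniq (take (index u (w :: q)).+1 (w :: q)).
  by apply: take_uniq; move: uq; rewrite cons_uniq => /andP[].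
have vT : v \notin w :: q by move: uq; rewrite cons_uniq => /andP[].
move: hi i1 sz uT pT sT unT; move: (index u _) (take _ _) => k T hi i1 sz uT pT sT unT.
have -> : is_cycle (v :: T).
  rewrite /is_cycle; apply/and3P; split.
  - by rewrite /= sz !ltnS.
  - by rewrite cons_uniq unT andbT; apply: contra vT; exact: sT.
  - by rewrite (cycle_path v) /= pT andbT (last_nth v) sz /= uT gadj_sym.
by move=> /(_ isT); rewrite [size _]/= sz; move: hi => /=; lia.
Qed.

Hypothesis d1 : (1 <= d)%N.

Lemma sum_free_neighbours (x : R) v q w : path (@gadj G) v (w :: q) -> uniq (v :: w :: q) ->
  (size q + 2 <= L)%N ->
  \sum_(u in ~: [set x in w :: q] :\ v | @gadj G v u) x = (d%:R - 1) * x.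
Proof.
move=> pq uq sq; rewrite -(natrB _ d1) subn1 -(card_free_neighbours pq uq sq).
rewrite mulr_natl -sumr_const; apply: eq_bigl => u; rewrite [RHS]in_set.
by [].
Qed.

Lemma sum_neighbours (x : R) v : \sum_(u in [set: V] :\ v | @gadj G v u) x = d%:R * x.
Proof.
rewrite -(regG v) mulr_natl -sumr_const; apply: eq_bigl => u; rewrite !inE andbT.
by case: (boolP (gadj v u)) => [/gadj_neq|]; rewrite ?andbF// eq_sym => ->.
Qed.

Variables (t eta : R).
Hypothesis t0 : 0 <= t.
Hypothesis eta0 : 0 < eta.
Hypothesis eta_eq : (d%:R - 1) * t * eta ^+ 2 + eta = 1.
Let s := (d%:R - 1) * t.
Let c := s / (1 + s).

Let s0 : 0 <= s. Proof. by rewrite mulr_ge0// subr_ge0 ler1n. Qed.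
Let c0 : 0 <= c. Proof. by rewrite /c divr_ge0//; have := s0; lra. Qed.
Let dt0 : 0 <= d%:R * t. Proof. by rewrite mulr_ge0. Qed.
Let eta1 : eta <= 1.
Proof. by rewrite -eta_eq lerDr mulr_ge0// sqr_ge0. Qed.
Let eta_inv : eta^-1 = 1 + s * eta.
Proof.
have e0 : eta != 0 by rewrite gt_eqF.
apply: (mulIf e0); rewrite mulVf//; rewrite -[LHS]eta_eq /s; ring.
Qed.

(** Induction on the remaining depth [n], the deleted vertices forming a path that starts at [w].
    Multiplicative bounds in both directions are kept because they pass through the reciprocal in
    the recursion. *)
Lemma vratio_path_bound n v w q : path (@gadj G) v (w :: q) -> uniq (v :: w :: q) ->
  (size q + 2 + n <= L)%N ->
  let y := vratio (~: [set x in w :: q]) v t in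
  let A := 1 + d%:R * t * c ^+ n in
  y <= eta * A /\ eta <= A * y.
Proof.
elim: n v w q => [|n IH] v w q pq uq sq y A.
all: have vW : v \in ~: [set x in w :: q] by move: uq; rewrite !inE /= inE => /andP[].
all: have yE : y = (1 + t * \sum_(u in ~: [set x in w :: q] :\ v | @gadj G v u)
      vratio (~: [set x in w :: q] :\ v) u t)^-1
  by rewrite /y vratio_rec// gt_eqF ?Zm_gt0.
all: set S := t * _ in yE.
all: have S0 : 0 <= S by rewrite /S mulr_ge0// sumr_ge0// => u _; apply/ltW/vratio_gt0.
all: have Ss : S <= s.
1,3: rewrite /S /s mulrC ler_wpM2r// -[leRHS]mulr1 -(@sum_free_neighbours 1 v q w pq uq).
1,3: by apply: ler_sum => u /andP[uW _]; exact: vratio_le1.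
1,2: exact: leq_trans (leq_addr _ _) sq.
- have y0 : 0 < 1 + S by lra.
  (* At depth 0 it is enough that [y] and [eta] both lie between [1 / (1 + s)] and 1. *)
  have h : 1 + s <= A by rewrite /A expr0 mulr1 /s lerD2l ler_wpM2r// gerBl.
  rewrite yE; split.
    apply: (@le_trans _ _ 1); first by rewrite invf_le1//; lra.
    rewrite -(mulfV (lt0r_neq0 eta0)) ler_pM2l// eta_inv.
    apply: le_trans h; rewrite lerD2l; exact: ler_piMr.
  apply: (le_trans eta1); rewrite ler_pdivlMr// mul1r; lra.
- have A1 : 1 <= 1 + d%:R * t * c ^+ n by rewrite lerDl mulr_ge0// exprn_ge0.
  have AE : A = 1 + s / (1 + s) * (1 + d%:R * t * c ^+ n - 1).
    by rewrite /A exprS /c; ring.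
  have ch u : u \in ~: [set x in w :: q] :\ v -> @gadj G v u ->
      let z := vratio (~: [set x in w :: q] :\ v) u t in
      z <= eta * (1 + d%:R * t * c ^+ n) /\ eta <= (1 + d%:R * t * c ^+ n) * z.
    (* Deleting [v] too prolongs the deleted path by one vertex, so the induction hypothesis applies
       to each [u]. *)
    have -> : ~: [set x in w :: q] :\ v = ~: [set x in v :: w :: q].
      by apply/setP => x; rewrite !inE -negb_or.
    move=> uW vu; apply: IH.
    - by move: pq; rewrite /= [gadj u v]gadj_sym vu.
    - move: uW; rewrite in_setC inE => uW.
      by rewrite cons_uniq uW uq.
    - by move: sq; rewrite addnS /= !addSn.
  have sE : s * eta = t * \sum_(u in ~: [set x in w :: q] :\ v | @gadj G v u) eta.
    by rewrite (sum_free_neighbours _ pq uq) /s; [ring|exact: leq_trans (leq_addr _ _) sq].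
  have B1 : S <= (1 + d%:R * t * c ^+ n) * (s * eta).
    rewrite sE mulrCA ler_wpM2l// mulr_sumr; apply: ler_sum => u /andP[h1 h2].
    by have [+ _] := ch u h1 h2; rewrite mulrC.
  have B2 : s * eta <= (1 + d%:R * t * c ^+ n) * S.
    rewrite sE mulrCA ler_wpM2l// mulr_sumr; apply: ler_sum => u /andP[h1 h2].
    by have [_ +] := ch u h1 h2.
  have H0 : 0 <= s * eta <= s by rewrite mulr_ge0 ?(ltW eta0)//= ler_piMr.
  have S0s : 0 <= S <= s by rewrite S0.
  (* The contraction is used in both directions, with [S] and [s * eta] exchanging roles. *)
  have C1 := contraction_step s0 A1 H0 B1.
  have C2 := contraction_step s0 A1 S0s B2.
  rewrite -AE -eta_inv in C1 C2.
  rewrite yE; split.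
    rewrite -div1r ler_pdivrMr; last lra.
    rewrite -[leLHS](mulfV (lt0r_neq0 eta0)) -mulrA ler_pM2l//; exact: C2.
  rewrite ler_pdivlMr; last lra.
  by rewrite mulrC -ler_pdivlMr//; exact: C1.
Qed.

(** The root keeps all [d] neighbours, hence [d] in its limit ratio. The map [x -> 1 / (1 + x)] is
    1-Lipschitz for [x >= 0]; one factor [d%:R * t] comes from the sum, the other from the path
    bound. *)
Lemma vratio_root_bound n v : (n + 2 <= L)%N ->
  `|vratio [set: V] v t - (1 + d%:R * t * eta)^-1| <= (d%:R * t) ^+ 2 * c ^+ n.
Proof.
move=> nL; rewrite vratio_rec ?inE// ?gt_eqF ?Zm_gt0//.
set S := t * _.
have S0 : 0 <= S by rewrite /S mulr_ge0// sumr_ge0// => u _; apply/ltW/vratio_gt0.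
have H0 : 0 <= d%:R * t * eta by rewrite mulr_ge0 ?(ltW eta0).
have c0n : 0 <= d%:R * t * c ^+ n by rewrite mulr_ge0// exprn_ge0.
have lip (a b : R) : 0 <= a -> 0 <= b -> `|(1 + a)^-1 - (1 + b)^-1| <= `|a - b|.
  move=> a0 b0; rewrite (_ : _ - _ = (b - a) / ((1 + a) * (1 + b))); last by field; lra.
  rewrite normrM distrC ler_piMr// ger0_norm ?invf_le1 ?invr_ge0; nra.
apply: (le_trans (lip _ _ S0 H0)).
have -> : d%:R * t * eta = t * \sum_(u in [set: V] :\ v | @gadj G v u) eta.
  by rewrite sum_neighbours; ring.
rewrite /S -mulrBr normrM ger0_norm// -sumrB.
have -> : (d%:R * t) ^+ 2 * c ^+ n = t * (d%:R * (d%:R * t * c ^+ n)) by ring.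
rewrite ler_wpM2l//; apply: le_trans (ler_norm_sum _ _ _) _.
rewrite -(sum_neighbours _ v); apply: ler_sum => u /andP[uW vu].
have [] := @vratio_path_bound n u v [::].
- by rewrite /= [gadj u v]gadj_sym vu.
- by rewrite /= inE eq_sym (gadj_neq vu).
- by rewrite add0n addnC.
have -> : ~: [set x in [:: v]] = [set: V] :\ v by apply/setP => x; rewrite !inE andbT.
set y := vratio _ _ _ => b1 b2.
have y1 : y <= 1 by apply: vratio_le1 => //; rewrite !inE eq_sym (gadj_neq vu).
have y0 : 0 < y by exact: vratio_gt0.
(* As [y] and [eta] are at most 1, the relative error bounds the absolute one. *)
rewrite ler_norml; apply/andP; split; nra.
Qed.

(** [pG] is the mean over [v] of the probability that a random matching covers [v]. *)
Lemma pG_vratio : (0 < gv G)%N ->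
  pG G t = (\sum_(v : V) (1 - vratio [set: V] v t)) / (gv G)%:R.
Proof.
move=> n0; have Z0 := Zm_gt0 [set: V] t0.
have n0' : (gv G)%:R != 0 :> R by rewrite pnatr_eq0 -lt0n.
rewrite /pG Mpoly_deriv Mpoly_horner.
rewrite (eq_bigr (fun v => Zm [set: V] t * (1 - vratio [set: V] v t))); last first.
  by move=> v _; rewrite /vratio mulrBr mulr1 mulrC divfK// gt_eqF.
by rewrite -mulr_sumr [X in _ / X]mulrC -mulf_div divff ?mul1r// gt_eqF.
Qed.

Lemma pG_bound n : (0 < gv G)%N -> (n + 2 <= L)%N ->
  `|pG G t - (1 - (1 + d%:R * t * eta)^-1)| <= (d%:R * t) ^+ 2 * c ^+ n.
Proof.
move=> n0 nL; rewrite pG_vratio//.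
have n0' : (gv G)%:R != 0 :> R by rewrite pnatr_eq0 -lt0n.
set r := (1 + _)^-1.
have -> : 1 - r = (\sum_(v : V) (1 - r)) / (gv G)%:R.
  by rewrite sumr_const card_ord -(mulr_natr (1 - r)) mulfK.
rewrite -mulrBl -sumrB normrM [`|_^-1|]ger0_norm ?invr_ge0// ler_pdivrMr ?ltr0n//.
apply: (le_trans (ler_norm_sum _ _ _)).
rewrite [leRHS](_ : _ = \sum_(v : V) (d%:R * t) ^+ 2 * c ^+ n); last first.
  by rewrite sumr_const card_ord mulr_natr.
apply: ler_sum => v _; rewrite (_ : _ - _ = r - vratio [set: V] v t); last by ring.
by rewrite distrC; exact: vratio_root_bound.
Qed.

End Ratio.

(** * The parametrization by eta *)

Section EtaParametrization.
Variables (R : realType) (d : nat).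
Hypothesis d2 : (2 <= d)%N.
Implicit Types (t x : R).

Let dR : 2 <= d%:R :> R. Proof. by rewrite (ler_nat _ 2). Qed.

(* [eta d t] rationalized, so that [t = 0] gives [1] instead of [0 / 0]. *)
Definition etar t : R := 2 / (1 + Num.sqrt (1 + 4 * (d%:R - 1) * t)).

Let disc0 t : 0 <= t -> 1 <= 1 + 4 * (d%:R - 1) * t.
Proof. by move=> t0; rewrite lerDl !mulr_ge0//; have := dR; lra. Qed.

Lemma etar_gt0 t : 0 < etar t.
Proof. by rewrite divr_gt0// ltr_pwDl// sqrtr_ge0. Qed.

Lemma etar_eq t : 0 <= t -> (d%:R - 1) * t * etar t ^+ 2 + etar t = 1.
Proof.
move=> t0; rewrite /etar.
have := sqr_sqrtr (le_trans ler01 (disc0 t0)); have := sqrtr_ge0 (1 + 4 * (d%:R - 1) * t).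
set q := Num.sqrt _ => q0 qE.
have -> : (d%:R - 1) * t = (q ^+ 2 - 1) / 4 by rewrite qE; field.
by field; lra.
Qed.

Lemma etar_le1 t : 0 <= t -> etar t <= 1.
Proof.
move=> t0; rewrite -[leRHS](etar_eq t0) lerDr !mulr_ge0 ?sqr_ge0//.
by have := dR; lra.
Qed.

Lemma eta_etar t : 0 < t -> Pilot.Defs.eta d t = etar t.
Proof.
move=> t0; rewrite /Defs.eta /etar.
have := sqr_sqrtr (le_trans ler01 (disc0 (ltW t0))).
have := sqrtr_ge0 (1 + 4 * (d%:R - 1) * t).
set q := Num.sqrt _ => q0 qE.
have h : 0 < (d%:R - 1) * t by rewrite mulr_gt0//; have := dR; lra.
have e : (d%:R - 1) * t = (q ^+ 2 - 1) / 4 by rewrite qE; field.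
rewrite -[2 * _ * t]mulrA e in h *.
have q1 : 1 < q by rewrite -(ltr_sqr) ?nnegrE//; lra.
by field; lra.
Qed.

(** The equation of [etar_eq] solved for [t], hence the inverse of [etar d] on [t >= 0]; [x = 1]
    corresponds to [t = 0]. *)
Definition t_of_eta x : R := (1 - x) / ((d%:R - 1) * x ^+ 2).

Lemma t_of_etar t : 0 <= t -> t_of_eta (etar t) = t.
Proof.
move=> t0; have e0 := etar_gt0 t; rewrite /t_of_eta -{1}(etar_eq t0) addrK.
by have dR' := dR; field; lra.
Qed.

Lemma t_of_eta_ge0 x : 0 < x <= 1 -> 0 <= t_of_eta x.
Proof.
move=> /andP[x0 x1]; rewrite divr_ge0 ?mulr_ge0 ?sqr_ge0//; have := dR; lra.
Qed.

Lemma t_of_eta_eq x : 0 < x -> (d%:R - 1) * t_of_eta x * x ^+ 2 + x = 1.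
Proof. by move=> x0; rewrite /t_of_eta; have dR' := dR; field; lra. Qed.

(* Limit of [ln M(G,t) / v(G)], as a function of [x = etar t]. *)
Definition Flim x : R := - ln x + (d%:R - 2) / 2 * (ln (d%:R - 1) - ln (d%:R - x)).

Lemma is_derive_Flim x : 0 < x <= 1 ->
  is_derive x 1 Flim (- x^-1 + (d%:R - 2) / 2 * (d%:R - x)^-1).
Proof.
move=> /andP[x0 x1]; have dx : 0 < d%:R - x by have := dR; lra.
rewrite /Flim.
have h1 := is_derive1_ln x0.
have h2 : is_derive x (1 : R) (fun y : R => d%:R - y) (-1).
  by apply: is_derive_eq; ring.
have h3 := @is_derive1_comp _ (@ln R) (fun y : R => d%:R - y) x _ _ (is_derive1_ln dx) h2.
rewrite /comp in h3.
apply: is_derive_eq; rewrite /GRing.scale /=; ring.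
Qed.

Lemma is_derive_t_of_eta x : 0 < x -> 
  is_derive x 1 t_of_eta (- (2 - x) / ((d%:R - 1) * x ^+ 3)).
Proof.
move=> x0; rewrite /t_of_eta.
have nz : (d%:R - 1) * x ^+ 2 != 0 by rewrite mulf_neq0 ?expf_neq0//; have := dR; lra.
have h2 : is_derive x (1 : R) (fun y : R => (d%:R - 1) * y ^+ 2) (2 * (d%:R - 1) * x).
  by apply: is_derive_eq; rewrite /GRing.scale /= /GRing.scale/=; ring.
have h3 := @is_deriveV _ (fun y : R => (d%:R - 1) * y ^+ 2) x _ 1 nz h2.
apply: is_derive_eq; rewrite /GRing.scale /=.
by have dR' := dR; field; lra.
Qed.

Section Bound.
Variables (G : graph) (L n : nat).
Hypothesis regG : regular d G.
Hypothesis girthG : forall s : seq 'I_(gv G), is_cycle s -> (L < size s)%N.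
Hypothesis vG : (0 < gv G)%N.
Hypothesis nL : (n + 2 <= L)%N.

Lemma Mpoly_gt0 t : 0 <= t -> 0 < (Mpoly R G).[t].
Proof. by move=> t0; rewrite Mpoly_horner Zm_gt0. Qed.

(** The error of the normalized logarithm in the variable [x]; it vanishes at [x = 1], and [psi'] is
    its derivative by the chain rule. *)
Let psi x := ln (Mpoly R G).[t_of_eta x] / (gv G)%:R - Flim x.

Let psi' x := (Mpoly R G)^`().[t_of_eta x] / (Mpoly R G).[t_of_eta x] / (gv G)%:R
    * (- (2 - x) / ((d%:R - 1) * x ^+ 3))
    - (- x^-1 + (d%:R - 2) / 2 * (d%:R - x)^-1).

Let is_derive_psi x : 0 < x <= 1 -> is_derive x 1 psi (psi' x).
Proof.
move=> x01; have /andP[x0 x1] := x01.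
have h1 := is_derive_t_of_eta x0.
have M0 := Mpoly_gt0 (t_of_eta_ge0 x01).
have h2 := @is_derive1_comp _ (horner (Mpoly R G)) t_of_eta x _ _
  (is_derive_poly _ _) h1.
have h3 := @is_derive1_comp _ (@ln R) (horner (Mpoly R G) \o t_of_eta) x _ _ (is_derive1_ln M0) h2.
have h4 := is_derive_Flim x01.
rewrite /comp in h3; rewrite /psi /psi'.
apply: is_derive_eq; rewrite /GRing.scale /=; ring.
Qed.

(** The derivative of [Flim d] is the limit of [pG] over [2 * t], times [dt/dx], so [psi'] is the
    error of [pG] times the same factor. The square of [t] in [pG_bound] absorbs the division by
    [t], and the other factors are bounded by monotonicity in [x]. *)
Let psi'_bound e x : 0 < e -> e < x < 1 ->
  `|psi' x| <= d%:R ^+ 2 * t_of_eta e / ((d%:R - 1) * e ^+ 3)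
     * ((1 - e) / (e ^+ 2 + 1 - e)) ^+ n.
Proof.
move=> e0 /andP[ex x1]; have x0 : 0 < x by lra.
have d1 : 0 < d%:R - 1 :> R by have := dR; lra.
set t := t_of_eta x.
have t0 : 0 < t by rewrite /t /t_of_eta divr_gt0 ?mulr_gt0 ?exprn_gt0//; lra.
have v0 : 0 < (gv G)%:R :> R by rewrite ltr0n.
have M0 := Mpoly_gt0 (ltW t0).
have := pG_bound regG girthG (ltnW d2) (ltW t0) x0 (t_of_eta_eq x0) vG nL.
set P := 1 - _ => bd.
have -> : psi' x = (pG G t - P) / (2 * t) * (- (2 - x) / ((d%:R - 1) * x ^+ 3)).
  have e1 : (Mpoly R G)^`().[t] / (Mpoly R G).[t] / (gv G)%:R = pG G t / (2 * t).
    by rewrite /pG; field; rewrite !lt0r_neq0.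
  have e2 : - x^-1 + (d%:R - 2) / 2 * (d%:R - x)^-1 =
      P / (2 * t) * (- (2 - x) / ((d%:R - 1) * x ^+ 3)).
    rewrite /P /t /t_of_eta; have dx : 0 < d%:R - x by lra.
    have -> : 1 + d%:R * ((1 - x) / ((d%:R - 1) * x ^+ 2)) * x =
      (d%:R - x) / ((d%:R - 1) * x) by field; lra.
    by field; lra.
  by rewrite /psi' -/t e1 e2 -!mulrBl.
have tT : t <= t_of_eta e.
  rewrite /t /t_of_eta ler_pM ?invr_ge0 ?mulr_ge0 ?sqr_ge0 ?lef_pV2 ?posrE ?mulr_gt0 ?exprn_gt0 ?ler_pM2l//; try lra.
  by rewrite ler_sqr ?nnegrE; lra.
(* In the variable [x] the product [(d%:R - 1) * t] is [(1 - x) / x ^+ 2], which is free of [d]. *)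
have cE : (d%:R - 1) * t / (1 + (d%:R - 1) * t) = (1 - x) / (x ^+ 2 + 1 - x).
  have h : 0 < x ^+ 2 + 1 - x by nra.
  rewrite /t /t_of_eta.
  have -> : (d%:R - 1) * ((1 - x) / ((d%:R - 1) * x ^+ 2)) = (1 - x) / x ^+ 2 by field; lra.
  by field; lra.
have cc : ((1 - x) / (x ^+ 2 + 1 - x)) ^+ n <= ((1 - e) / (e ^+ 2 + 1 - e)) ^+ n.
  have hx : 0 < x ^+ 2 + 1 - x by nra.
  have he : 0 < e ^+ 2 + 1 - e by nra.
  rewrite lerXn2r ?nnegrE ?divr_ge0 ?(ltW hx) ?(ltW he)//; try lra.
  rewrite ler_pdivrMr// mulrAC ler_pdivlMr// -subr_ge0.
  rewrite (_ : _ - _ = (x - e) * (x + e * (1 - x))); last by ring.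
  by apply: mulr_ge0; nra.
have cn0 : 0 <= ((1 - x) / (x ^+ 2 + 1 - x)) ^+ n.
  by rewrite exprn_ge0// divr_ge0//; [lra|nra].
rewrite cE in bd; rewrite -mulrA normrM.
apply: (@le_trans _ _ ((d%:R * t) ^+ 2 * ((1 - x) / (x ^+ 2 + 1 - x)) ^+ n *
    `|(2 * t)^-1 * (- (2 - x) / ((d%:R - 1) * x ^+ 3))|)).
  by rewrite ler_wpM2r.
have x3 : 0 < (d%:R - 1) * x ^+ 3 by rewrite mulr_gt0 ?exprn_gt0.
have e3 : 0 < (d%:R - 1) * e ^+ 3 by rewrite mulr_gt0 ?exprn_gt0.
have -> : `|(2 * t)^-1 * (- (2 - x) / ((d%:R - 1) * x ^+ 3))| =
    (2 * t)^-1 * ((2 - x) / ((d%:R - 1) * x ^+ 3)).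
  rewrite mulNr mulrN normrN ger0_norm// mulr_ge0 ?invr_ge0 ?divr_ge0//; lra.
have -> : (d%:R * t) ^+ 2 * ((1 - x) / (x ^+ 2 + 1 - x)) ^+ n *
    ((2 * t)^-1 * ((2 - x) / ((d%:R - 1) * x ^+ 3))) =
    d%:R ^+ 2 * (t * ((2 - x) / 2 / ((d%:R - 1) * x ^+ 3))) * ((1 - x) / (x ^+ 2 + 1 - x)) ^+ n.
  by field; rewrite !lt0r_neq0//; nra.
rewrite -[d%:R ^+ 2 * _ / _]mulrA.
have y0 : 0 <= (2 - x) / 2 / ((d%:R - 1) * x ^+ 3).
  by rewrite !divr_ge0 ?(ltW x3)//; lra.
apply: ler_pM => //; first by apply: mulr_ge0 (sqr_ge0 _) (mulr_ge0 (ltW t0) y0).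
rewrite ler_wpM2l ?sqr_ge0//; apply: ler_pM => //; first lra.
apply: (@le_trans _ _ (1 / ((d%:R - 1) * x ^+ 3))).
  rewrite ler_wpM2r ?invr_ge0; lra.
rewrite mul1r lef_pV2 ?posrE// ler_pM2l// lerXn2r ?nnegrE; lra.
Qed.

(** Mean value theorem for [psi] on [[e, 1]], an interval of length at most 1 at whose right end
    [psi] is zero. *)
Lemma ln_Mpoly_bound e : 0 < e <= 1 ->
  `|ln (Mpoly R G).[t_of_eta e] / (gv G)%:R - Flim e| <=
    d%:R ^+ 2 * t_of_eta e / ((d%:R - 1) * e ^+ 3)
     * ((1 - e) / (e ^+ 2 + 1 - e)) ^+ n.
Proof.
move=> /andP[e0 e1]; rewrite -/(psi e).
have psi1 : psi 1 = 0.
  rewrite /psi /t_of_eta subrr mul0r Mpoly_horner Zm_at0 ln1 /Flim ln1.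
  by rewrite subrr mulr0 mul0r; ring.
have K0 : 0 <= d%:R ^+ 2 * t_of_eta e / ((d%:R - 1) * e ^+ 3)
     * ((1 - e) / (e ^+ 2 + 1 - e)) ^+ n.
  have d1 : 0 <= d%:R - 1 :> R by have := dR; lra.
  have te : 0 <= t_of_eta e by apply: t_of_eta_ge0; rewrite e0.
  rewrite mulr_ge0// ?exprn_ge0//.
    by rewrite divr_ge0// mulr_ge0// ?exprn_ge0 ?(ltW e0).
  by rewrite divr_ge0//; [lra|nra].
move: e1; rewrite le_eqVlt => /orP[/eqP eE|e1].
  by move: K0; rewrite eE psi1 normr0.
have [|||c] := @MVT _ psi psi' e 1.
- by [].
- move=> x; rewrite in_itv /= => /andP[ex x1]; apply: is_derive_psi; lra.
- apply: derivable_within_continuous => x; rewrite in_itv /= => /andP[ex x1].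
  by have [] : is_derive x 1 psi (psi' x) by apply: is_derive_psi; lra.
rewrite in_itv /= psi1 sub0r => cc h.
rewrite -normrN h normrM; apply: (@le_trans _ _ (`|psi' c| * 1)).
  by rewrite ler_wpM2l// ger0_norm; lra.
by rewrite mulr1; exact: psi'_bound.
Qed.

End Bound.
End EtaParametrization.

(** * Monotonicity, and the limits in closed form *)

(** Both factors are nonnegative for [k >= l], and swapping [k] and [l] flips both signs. *)
Lemma mulrB_expr_ge0 (R : realDomainType) (s t : R) (k l : nat) : 0 <= s <= t ->
  0 <= (k%:R - l%:R) * (t ^+ k * s ^+ l - s ^+ k * t ^+ l).
Proof.
move=> /andP[s0 st]; have t0 := le_trans s0 st.
wlog lk : k l / (l <= k)%N.
  move=> H; case: (leqP l k) => [|/ltnW] /H //; congr (0 <= _); ring.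
rewrite mulr_ge0//; first by rewrite subr_ge0 ler_nat.
rewrite -(subnK lk) !exprD (_ : _ - _ = (t ^+ (k - l) - s ^+ (k - l)) * (t ^+ l * s ^+ l)).
  by rewrite mulr_ge0 ?mulr_ge0 ?exprn_ge0// subr_ge0 lerXn2r.
by move: (t ^+ (k - l)) (s ^+ (k - l)) (t ^+ l) (s ^+ l) => a b e f; ring.
Qed.

(** Chebyshev's argument: twice the difference is a double sum over pairs, and symmetrizing it gives
    the nonnegative terms of [mulrB_expr_ge0]. *)
Lemma sum_expr_monotone (R : realDomainType) (I : finType) (P : pred I) (k : I -> nat) (s t : R) :
  0 <= s <= t ->
  (\sum_(i | P i) (k i)%:R * s ^+ k i) * (\sum_(i | P i) t ^+ k i) <=
  (\sum_(i | P i) (k i)%:R * t ^+ k i) * (\sum_(i | P i) s ^+ k i).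
Proof.
move=> st; rewrite -subr_ge0 -(pmulr_rge0 _ (ltr0Sn R 1)) mulr2n mulrDl mul1r.
rewrite !big_distrlr /= -sumrB.
under eq_bigr do rewrite -sumrB.
rewrite {2}exchange_big /= -big_split /= sumr_ge0// => i _.
rewrite -big_split /= sumr_ge0// => j _.
by have := mulrB_expr_ge0 (k i) (k j) st; congr (0 <= _); ring.
Qed.

Section FiniteGraph.
Variables (R : realType) (G : graph).
Hypothesis vG : (0 < gv G)%N.
Implicit Types (s t p : R).

Let v0 : 0 < (gv G)%:R :> R. Proof. by rewrite ltr0n. Qed.

Lemma Mpoly_sum t : (Mpoly R G).[t] =
  \sum_(M : {set {set 'I_(gv G)}} | is_matching M) t ^+ #|M|.
Proof. by rewrite Mpoly_horner; apply: eq_bigl => M; rewrite finset.subsetT andbT. Qed.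

Lemma Mpoly_monotone s t : 0 <= s <= t -> (Mpoly R G).[s] <= (Mpoly R G).[t].
Proof.
move=> /andP[s0 st]; rewrite !Mpoly_sum; apply: ler_sum => M _.
by rewrite lerXn2r ?nnegrE// (le_trans s0).
Qed.

Lemma pG_sum t : pG G t = 2 / (gv G)%:R *
  ((\sum_(M : {set {set 'I_(gv G)}} | is_matching M) (#|M|)%:R * t ^+ #|M|)
   / (Mpoly R G).[t]).
Proof.
rewrite /pG Mpoly_deriv_sum mulf_div; congr (_ / _).
by rewrite mulr_sumr; apply: eq_bigr => M _; rewrite natrM mulrA.
Qed.

Lemma pG_monotone s t : 0 <= s <= t -> pG G s <= pG G t.
Proof.
move=> st; have /andP[s0 t0] := st; have t0' := le_trans s0 t0.
rewrite !pG_sum ler_wpM2l ?divr_ge0//.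
rewrite ler_pdivrMr ?Mpoly_gt0// mulrAC ler_pdivlMr ?Mpoly_gt0// !Mpoly_sum.
exact: sum_expr_monotone.
Qed.

Lemma pG_le_pstar t : 0 <= t -> pG G t <= pstar R G.
Proof.
move=> t0; rewrite pG_sum /pstar [leRHS]mulrAC ler_wpM2l ?divr_ge0//.
rewrite ler_pdivrMr ?Mpoly_gt0// Mpoly_sum mulr_sumr; apply: ler_sum => M mM.
rewrite ler_wpM2r ?exprn_ge0// ler_nat.
rewrite /nu; apply: (@leq_bigmax_cond _ (@is_matching G) (fun M : {set {set (ordinal (gv G))}} => #|M|) _ mM).
Qed.

Lemma pG_continuous t : 0 <= t -> {for t, continuous (pG G)}.
Proof.
move=> t0; rewrite /pG; apply: cvgM.
  by apply: cvgM; [apply: cvgM; [exact: cvg_cst|exact: cvg_id]|exact: continuous_horner].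
apply: cvgV; first by rewrite mulf_neq0// gt_eqF// Mpoly_gt0.
by apply: cvgM; [exact: cvg_cst|exact: continuous_horner].
Qed.

(** The intermediate value theorem on [[0, b]], with [pG G 0 = 0], provides a preimage, so [tG] does
    not fall back on its default 0. *)
Lemma tG_spec p b : 0 <= b -> 0 <= p <= pG G b -> 0 <= tG G p /\ pG G (tG G p) = p.
Proof.
move=> b0 pb.
suff ex : exists t : R, 0 <= t /\ pG G t = p.
  by have [] := xgetPex 0 ex.
have [||c cb <-] := @IVT R (pG G) 0 b p b0.
- apply: continuous_in_subspaceT => x; rewrite inE /= in_itv/= => /andP[x0 _].
  exact: pG_continuous.
- have -> : pG G 0 = 0 :> R by rewrite /pG mulr0 mul0r mul0r.
  by rewrite ge_min le_max; have /andP[-> ->] := pb; rewrite orbT.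
- by exists c; move: cb; rewrite in_itv /= => /andP[].
Qed.

End FiniteGraph.

(** * Closed forms for the tree *)

Section TreeFormulas.
Variables (R : realType) (d : nat).
Hypothesis d2 : (2 <= d)%N.
Implicit Types (t x p : R).

Let dR : 2 <= d%:R :> R. Proof. by rewrite (ler_nat _ 2). Qed.

(** Limit of [pG]: one minus the limiting ratio at the root, which has [d] children and not
    [d - 1]. *)
Definition Plim t : R := 1 - (1 + d%:R * t * etar d t)^-1.

(** The quadratic of [etar_eq] is injective on positive numbers: [y - x] divides the difference of
    two values, with cofactor [(d%:R - 1) * t * (x + y) + 1 > 0]. *)
Lemma t_of_etaK x : 0 < x <= 1 -> etar d (t_of_eta d x) = x.
Proof.
move=> x01; have /andP[x0 x1] := x01.
have t0 := t_of_eta_ge0 d2 x01; have e0 := etar_gt0 d (t_of_eta d x).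
have E := etar_eq d2 t0; have E' := t_of_eta_eq d2 x0.
set t := t_of_eta d x in t0 e0 E E' *; set y := etar d t in e0 E *.
have : (y - x) * ((d%:R - 1) * t * (x + y) + 1) = 0.
  transitivity (((d%:R - 1) * t * y ^+ 2 + y) - ((d%:R - 1) * t * x ^+ 2 + x)); first by ring.
  by rewrite E E' subrr.
move=> /eqP; rewrite mulf_eq0 subr_eq0 => /orP[/eqP//|/eqP h].
have d1 : 0 <= d%:R - 1 :> R by have := dR; lra.
have := mulr_ge0 (mulr_ge0 d1 t0) (addr_ge0 (ltW x0) (ltW e0)).
by move=> h'; move: h; clear -h'; lra.
Qed.

Lemma etar_anti s t : 0 <= s -> s < t -> etar d t < etar d s.
Proof.
move=> s0 st; rewrite /etar ltr_pM2l// ltf_pV2 ?posrE; last 2 first.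
- by rewrite ltr_pwDl// sqrtr_ge0.
- by rewrite ltr_pwDl// sqrtr_ge0.
have d1 : 0 < 4 * (d%:R - 1) :> R by have := dR; lra.
by rewrite ltrD2l ltr_sqrt ?ltrD2l ?ltr_pM2l// ltr_pwDl// mulr_ge0// ?ltW//; lra.
Qed.

Lemma PlimE t : 0 <= t -> Plim t = d%:R * (1 - etar d t) / (d%:R - etar d t).
Proof.
move=> t0; rewrite /Plim -{1}(t_of_etar d2 t0) /t_of_eta.
have := etar_gt0 d t; have := etar_le1 d2 t0; set x := etar d t => x1 x0.
have dR' := dR; have dx : 0 < d%:R - x by lra.
have -> : 1 + d%:R * ((1 - x) / ((d%:R - 1) * x ^+ 2)) * x =
      (d%:R - x) / ((d%:R - 1) * x) by field; lra.
by field; lra.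
Qed.

Lemma Plim_lt s t : 0 <= s -> s < t -> Plim s < Plim t.
Proof.
move=> s0 st; have t0 : 0 <= t by lra.
rewrite !PlimE//; have := etar_anti s0 st; have := etar_gt0 d t.
have := etar_le1 d2 s0; set x := etar d t; set y := etar d s => y1 x0 xy.
have dR' := dR; rewrite ltr_pdivrMr; last lra.
rewrite mulrAC ltr_pdivlMr; last lra.
rewrite -subr_gt0 (_ : _ - _ = d%:R * ((d%:R - 1) * (y - x))); last by ring.
by rewrite !mulr_gt0//; lra.
Qed.

Definition tlim p : R := p * (d%:R - p) / (d%:R ^+ 2 * (1 - p) ^+ 2).
(** The solution [x] of [p = d (1 - x) / (d - x)], the form that [PlimE] gives to [Plim]; [tlim] is
    then its image under [t_of_eta]. *)
Definition eta_of_p p : R := d%:R * (1 - p) / (d%:R - p).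

Lemma eta_of_p01 p : 0 <= p < 1 -> 0 < eta_of_p p <= 1.
Proof.
move=> /andP[p0 p1]; have dR' := dR; rewrite /eta_of_p divr_gt0 ?mulr_gt0; try lra.
by rewrite ler_pdivrMr; nra.
Qed.

Lemma tlim_eta p : 0 <= p < 1 -> tlim p = t_of_eta d (eta_of_p p).
Proof.
move=> /andP[p0 p1]; have dR' := dR; rewrite /tlim /t_of_eta /eta_of_p.
have -> : 1 - d%:R * (1 - p) / (d%:R - p) = p * (d%:R - 1) / (d%:R - p) by field; lra.
by field; lra.
Qed.

Lemma tlim_ge0 p : 0 <= p < 1 -> 0 <= tlim p.
Proof. by move=> p01; rewrite tlim_eta//; exact/t_of_eta_ge0/eta_of_p01. Qed.

Lemma etar_tlim p : 0 <= p < 1 -> etar d (tlim p) = eta_of_p p.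
Proof. by move=> p01; rewrite tlim_eta// t_of_etaK// eta_of_p01. Qed.

Lemma Plim_tlim p : 0 <= p < 1 -> Plim (tlim p) = p.
Proof.
move=> p01; have /andP[p0 p1] := p01; rewrite PlimE ?tlim_ge0// etar_tlim// /eta_of_p.
have dR' := dR.
have -> : 1 - d%:R * (1 - p) / (d%:R - p) = p * (d%:R - 1) / (d%:R - p) by field; lra.
have -> : d%:R - d%:R * (1 - p) / (d%:R - p) = d%:R * (d%:R - 1) / (d%:R - p) by field; lra.
by field; lra.
Qed.

Lemma Plim_closed t : 0 <= t -> Plim t =
  (2 * d%:R ^+ 2 * t + d%:R - d%:R * Num.sqrt (1 + 4 * (d%:R - 1) * t))
  / (2 * d%:R ^+ 2 * t + 2).
Proof.
move=> t0; rewrite /Plim /etar.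
have h : 0 <= 4 * (d%:R - 1) * t by rewrite !mulr_ge0//; have := dR; lra.
have := sqr_sqrtr (addr_ge0 ler01 h); have := sqrtr_ge0 (1 + 4 * (d%:R - 1) * t).
set q := Num.sqrt _ => q0 qE.
have dR' := dR.
have -> : t = (q ^+ 2 - 1) / (4 * (d%:R - 1)) by rewrite qE; field; lra.
have q1 : 1 <= q by rewrite -(ler_sqr) ?nnegrE//; lra.
have h1 : 0 <= d%:R * (q - 1) by rewrite mulr_ge0//; lra.
have h2 : 0 <= d%:R ^+ 2 * (q ^+ 2 - 1) by rewrite mulr_ge0 ?sqr_ge0//; lra.
have -> : 1 + d%:R * ((q ^+ 2 - 1) / (4 * (d%:R - 1))) * (2 / (1 + q)) =
  (2 * (d%:R - 1) + d%:R * (q - 1)) / (2 * (d%:R - 1)) by field; lra.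
by field; lra.
Qed.

Lemma lambdaT_lim p : 0 < p < 1 ->
  Flim d (eta_of_p p) - 2^-1 * p * ln (tlim p) = lambdaT d p.
Proof.
move=> /andP[p0 p1]; have dR' := dR.
have dp : 0 < d%:R - p by lra.
have pp : 0 < 1 - p by lra.
have d0 : 0 < d%:R :> R by lra.
have d1 : 0 < d%:R - 1 :> R by lra.
rewrite /lambdaT /Flim.
have -> : d%:R - eta_of_p p = d%:R * (d%:R - 1) / (d%:R - p).
  by rewrite /eta_of_p; field; lra.
have -> : 1 - p / d%:R = (d%:R - p) / d%:R by field; lra.
rewrite /eta_of_p /tlim.
(* Both sides become linear combinations of the logarithms of [p], [1 - p], [d], [d - 1] and
   [d - p], and these agree. *)
do ![rewrite ln_div ?posrE ?mulr_gt0 ?exprn_gt0 ?divr_gt0// |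
     rewrite lnM ?posrE ?mulr_gt0 ?exprn_gt0 ?divr_gt0// |
     rewrite lnXn// ].

by field; lra.
Qed.

Lemma Flim_Sd t : 0 < t -> Flim d (etar d t) = 2^-1 * ln (Sd d t).
Proof.
move=> t0; rewrite /Sd (eta_etar d2 t0) /Flim.
have := etar_gt0 d t; have := etar_le1 d2 (ltW t0); move: (etar d t) => x x1 x0.
have dR' := dR; have dx : 0 < d%:R - x by lra.
have d1 : 0 < d%:R - 1 :> R by lra.
have y0 : 0 < (d%:R - 1) / (d%:R - x) by rewrite divr_gt0.
have -> : ln ((x ^+ 2)^-1 * ((d%:R - 1) / (d%:R - x)) ^+ (d - 2)) =
    - (ln x *+ 2) + ln ((d%:R - 1) / (d%:R - x)) *+ (d - 2).
  rewrite lnM ?posrE ?invr_gt0 ?exprn_gt0//; congr (_ + _); last by rewrite lnXn.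
  by rewrite lnV ?posrE ?exprn_gt0// lnXn.
rewrite ln_div ?posrE// -(mulr_natr (ln x)) -(mulr_natr (_ - _)) natrB//; by field; lra.
Qed.

Lemma etar_continuous : continuous (etar d : R -> R).
Proof.
move=> t; rewrite /etar; apply: cvgM; first exact: cvg_cst.
apply: cvgV; first by rewrite gt_eqF// ltr_pwDl// sqrtr_ge0.
apply: cvgD; first exact: cvg_cst.
apply: (@continuous_comp _ _ _ (fun t => 1 + 4 * (d%:R - 1) * t) (@Num.sqrt R)).
  by apply: cvgD; [exact: cvg_cst|apply: cvgM; [exact: cvg_cst|exact: cvg_id]].
exact: sqrt_continuous.
Qed.

Lemma Flim_continuous x : 0 < x < d%:R -> {for x, continuous (Flim d : R -> R)}.
Proof.
move=> /andP[x0 x1]; rewrite /Flim; apply: cvgD.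
  by apply: cvgN; exact: continuous_ln.
apply: cvgM; first exact: cvg_cst.
apply: cvgB; first exact: cvg_cst.
apply: (@continuous_comp _ _ _ (fun x => d%:R - x) (@ln R)).
  by apply: cvgB; [exact: cvg_cst|exact: cvg_id].
by apply: continuous_ln; rewrite subr_gt0.
Qed.

Lemma Flim_etar_continuous t : 0 <= t -> {for t, continuous (fun t => Flim d (etar d t) : R)}.
Proof.
move=> t0; apply: (@continuous_comp _ _ _ (etar d : R -> R) (Flim d : R -> R)).
  exact: etar_continuous.
apply: Flim_continuous; rewrite etar_gt0 (le_lt_trans (etar_le1 d2 t0))//.
by have := dR; lra.
Qed.

End TreeFormulas.

(** * Limits along the graph sequence *)

Local Open Scope classical_set_scope.

(** The depth [n] is fixed first so that [K * c ^+ n] is small, with [K] and [c] independent of [i];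
    then the girth eventually exceeds [n + 2]. *)
Lemma cvg_of_geometric_bound (R : realType) (Gs : nat -> graph) (u : nat -> R) (l K c : R) :
  girth_to_infty Gs -> 0 <= c < 1 ->
  (forall i L n, (forall s : seq 'I_(gv (Gs i)), is_cycle s -> (L < size s)%N) ->
     (n + 2 <= L)%N -> `|u i - l| <= K * c ^+ n) ->
  u i @[i --> \oo] --> l.
Proof.
move=> girth /andP[c0 c1] bd; apply/cvgrPdist_lt => eps eps0.
have : geometric K c @ \oo --> (0 : R) by apply: cvg_geometric; rewrite ger0_norm.
move=> /cvgrPdist_lt /(_ _ eps0) [n _ /(_ n (leqnn n))] /=.
rewrite sub0r normrN => hn.
near=> i; rewrite distrC; apply: (@le_lt_trans _ _ (K * c ^+ n)); last first.
  by apply: le_lt_trans hn; rewrite ler_norm.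
apply: (bd i (n + 2)%N) => //.
by near: i; exact: girth.
Unshelve. all: by end_near. Qed.

Section GraphSequence.
Variables (R : realType) (d : nat) (Gs : nat -> graph).
Hypothesis d2 : (2 <= d)%N.
Hypothesis vGs : forall i, (0 < gv (Gs i))%N.
Hypothesis regGs : forall i, regular d (Gs i).
Hypothesis girthGs : girth_to_infty Gs.
Implicit Types (t p : R).

Let dR : 2 <= d%:R :> R. Proof. by rewrite (ler_nat _ 2). Qed.

Lemma pG_cvg t : 0 <= t -> pG (Gs i) t @[i --> \oo] --> Plim d t.
Proof.
move=> t0; have s0 : 0 <= (d%:R - 1) * t by rewrite mulr_ge0//; have := dR; lra.
apply: (@cvg_of_geometric_bound _ Gs _ _ ((d%:R * t) ^+ 2)
   ((d%:R - 1) * t / (1 + (d%:R - 1) * t))) => //.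
  by rewrite divr_ge0 ?addr_ge0//= ltr_pdivrMr ?mul1r ?ltrDr// ltr_pwDl.
move=> i L n gi nL; exact: (pG_bound (@regGs i) gi (ltnW d2) t0 (etar_gt0 d t) (etar_eq d2 t0) (vGs i) nL).
Qed.

Lemma ln_Mpoly_cvg t : 0 <= t ->
  ln (Mpoly R (Gs i)).[t] / (gv (Gs i))%:R @[i --> \oo] --> Flim d (etar d t).
Proof.
move=> t0; have e0 := etar_gt0 d t; have e1 := etar_le1 d2 t0.
set e := etar d t in e0 e1 *.
have he : 0 < e ^+ 2 + 1 - e by nra.
apply: (@cvg_of_geometric_bound _ Gs _ _
   (d%:R ^+ 2 * t_of_eta d e / ((d%:R - 1) * e ^+ 3))
   ((1 - e) / (e ^+ 2 + 1 - e))) => //.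
  apply/andP; split; first by apply: divr_ge0; lra.
  by rewrite ltr_pdivrMr// mul1r -subr_gt0 (_ : _ - _ = e ^+ 2) ?exprn_gt0//; ring.
move=> i L n gi nL; rewrite -{1}(t_of_etar d2 t0).
by apply: (ln_Mpoly_bound d2 (@regGs i) gi (vGs i) nL); rewrite e0.
Qed.

(** [Plim d] exceeds [p] at [tlim d p + 1], so [pG] eventually does too and [tG_spec] applies with
    this point as [b]. *)
Lemma tG_near p : 0 <= p < 1 ->
  \forall i \near \oo, 0 <= tG (Gs i) p /\ pG (Gs i) (tG (Gs i) p) = p.
Proof.
move=> p01; have t0 := tlim_ge0 d2 p01.
near=> i; apply: (@tG_spec _ (Gs i) (vGs i) p (tlim d p + 1)); first lra.
have /andP[-> _] /= := p01; apply/ltW.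
near: i; apply: cvgr_gt; first by apply: pG_cvg; lra.
by rewrite -[ltLHS](Plim_tlim d2 p01); apply: Plim_lt => //; lra.
Unshelve. all: by end_near. Qed.

(** [Plim d] increases strictly through [p] at [tlim d p]. Hence the values of [pG] at distance
    [eps] on either side eventually enclose [p], and monotonicity of [pG] traps [tG]. *)
Lemma tG_cvg p : 0 <= p < 1 -> tG (Gs i) p @[i --> \oo] --> tlim d p.
Proof.
move=> p01; have t0 := tlim_ge0 d2 p01; apply/cvgrPdist_lt => eps eps0.
near=> i; have [ti0 pti] : 0 <= tG (Gs i) p /\ pG (Gs i) (tG (Gs i) p) = p.
  by near: i; exact: tG_near.
have hi : p < pG (Gs i) (tlim d p + eps).
  near: i; apply: cvgr_gt; first by apply: pG_cvg; lra.
  by rewrite -[ltLHS](Plim_tlim d2 p01); apply: Plim_lt => //; lra.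
(* The left point may be negative; then [0 <= tG (Gs i) p] is already enough. *)
have lo : 0 <= tlim d p - eps -> pG (Gs i) (tlim d p - eps) < p.
  near: i; have [a0|a0] := leP 0 (tlim d p - eps); last by apply: nearW => i; lra.
  have hp : Plim d (tlim d p - eps) < p.
    by rewrite -[ltRHS](Plim_tlim d2 p01); apply: Plim_lt => //; lra.
  have near_lo : \forall i \near \oo, pG (Gs i) (tlim d p - eps) < p.
    by apply: cvgr_lt hp; exact: pG_cvg.
  by apply: filterS near_lo.
rewrite ltr_distlC; apply/andP; split; rewrite ltNge; apply/negP => h.
- have a0 : 0 <= tlim d p - eps by lra.
  have := lo a0; rewrite -{2}pti ltNge => /negP; apply.
  by apply: pG_monotone => //; rewrite ti0 //.
- have := hi; rewrite -{1}pti ltNge => /negP; apply.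
  by apply: pG_monotone => //; rewrite h andbT; lra.
Unshelve. all: by end_near. Qed.

(** The argument [tG (Gs i) p] moves with [i]. Convergence at two fixed points [a] and [b] around
    [tlim d p], with monotonicity of [Mpoly], stands in for uniform convergence. *)
Lemma ln_Mpoly_tG_cvg p : 0 <= p < 1 ->
  ln (Mpoly R (Gs i)).[tG (Gs i) p] / (gv (Gs i))%:R @[i --> \oo]
    --> Flim d (eta_of_p d p).
Proof.
move=> p01; have t0 := tlim_ge0 d2 p01; rewrite -(etar_tlim d2 p01).
apply/cvgrPdist_lt => eps eps0.
have /cvgrPdist_lt/(_ _ eps0) := Flim_etar_continuous d2 t0.
case=> del /= del0 hdel.
have del20 : 0 < del / 2 by rewrite divr_gt0.
(* [a] is cut at 0 because [ln_Mpoly_cvg] holds for nonnegative arguments. *)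
pose b := tlim d p + del / 2; pose a := Num.max 0 (tlim d p - del / 2).
have a0 : 0 <= a by rewrite le_max lexx.
have ab : tlim d p - del / 2 <= a by rewrite le_max lexx orbT.
have at_ : a <= tlim d p by rewrite ge_max t0; lra.
have Fa : `|Flim d (etar d (tlim d p)) - Flim d (etar d a)| < eps.
  by apply: hdel; rewrite /ball_/= ger0_norm; lra.
have Fb : `|Flim d (etar d (tlim d p)) - Flim d (etar d b)| < eps.
  by apply: hdel; rewrite /ball_/= /b ler0_norm; lra.
have b0 : 0 <= b by rewrite /b; lra.
near=> i.
have [ti0 pti] : 0 <= tG (Gs i) p /\ pG (Gs i) (tG (Gs i) p) = p.
  by near: i; exact: tG_near.
have : `|tlim d p - tG (Gs i) p| < del / 2.
  by near: i; move/cvgrPdist_lt: (tG_cvg p01); apply.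
rewrite ltr_distlC => /andP[h1 h2].
have v0 : 0 < (gv (Gs i))%:R^-1 :> R by rewrite invr_gt0 ltr0n.
have mono s t : 0 <= s <= t -> ln (Mpoly R (Gs i)).[s] / (gv (Gs i))%:R <=
   ln (Mpoly R (Gs i)).[t] / (gv (Gs i))%:R.
  move=> st; have /andP[s0 s1] := st.
  rewrite ler_pM2r// ler_ln ?posrE ?Mpoly_gt0//; last by lra.
  exact: Mpoly_monotone.
have lea : ln (Mpoly R (Gs i)).[a] / (gv (Gs i))%:R <=
   ln (Mpoly R (Gs i)).[tG (Gs i) p] / (gv (Gs i))%:R.
  by apply: mono; rewrite a0 ge_max ti0; lra.
have leb : ln (Mpoly R (Gs i)).[tG (Gs i) p] / (gv (Gs i))%:R <=
   ln (Mpoly R (Gs i)).[b] / (gv (Gs i))%:R.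
  by apply: mono; rewrite ti0 /b; lra.
rewrite ltr_distlC; apply/andP; split.
  apply: lt_le_trans lea; near: i; apply: cvgr_gt; first exact: ln_Mpoly_cvg.
  by move: Fa; rewrite ltr_distlC => /andP[].
apply: le_lt_trans leb _; near: i; apply: cvgr_lt; first exact: ln_Mpoly_cvg.
by move: Fb; rewrite ltr_distlC => /andP[].
Unshelve. all: by end_near. Qed.

Lemma lambdaG_cvg p : 0 <= p < 1 -> lambdaG (Gs i) p @[i --> \oo] --> lambdaT d p.
Proof.
move=> p01; have /andP[p0 p1] := p01.
(* At [p = 0] both sides are 0; elsewhere [tlim d p] is positive and the logarithm is continuous
   there. *)
have [->|pn0] := eqVneq p 0.
  rewrite /lambdaG eqxx (_ : lambdaT d 0 = 0); first exact: cvg_cst.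
  by rewrite /lambdaT !mul0r subr0 subr0 ln1 !mulr0; ring.
have p_gt0 : 0 < p by rewrite lt0r pn0.
have t0 : 0 < tlim d p.
  rewrite /tlim divr_gt0 ?mulr_gt0 ?exprn_gt0//; have := dR; lra.
rewrite -(lambdaT_lim d2); last by rewrite p_gt0.
have key : lambda0 (Gs i) p @[i --> \oo] -->
    Flim d (eta_of_p d p) - 2^-1 * p * ln (tlim d p).
  rewrite /lambda0; apply: cvgB; first exact: ln_Mpoly_tG_cvg.
  apply: cvgM; first exact: cvg_cst.
  by apply: (cvg_comp _ _ (tG_cvg p01)); exact: continuous_ln.
apply: cvg_trans key; apply: near_eq_cvg.
near=> i; rewrite /lambdaG (negbTE pn0).
(* Eventually [lambdaG] takes its [lambda0] branch: [p] lies below a value of [pG], hence below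
   [pstar]. *)
suff -> : p < pstar R (Gs i) by [].
apply: (@lt_le_trans _ _ (pG (Gs i) (tlim d p + 1))); last first.
  by apply: pG_le_pstar => //; lra.
near: i; apply: cvgr_gt; first by apply: pG_cvg; lra.
by rewrite -[ltLHS](Plim_tlim d2 p01); apply: Plim_lt => //; lra.
Unshelve. all: by end_near. Qed.

End GraphSequence.

(** With [x = s ^+ 2] the absolute value is [2 s^2 ln (1 / s)], and [ln (1 / s) < 1 / s] bounds it
    by [2 s], which is at most [eps]. *)
Lemma cvg_xlnx_0 (R : realType) : x * ln x @[x --> (0 : R)^'+] --> (0 : R).
Proof.
apply/cvgrPdist_le => eps eps0; near=> x.
have x0 : 0 < x by near: x; exact: nbhs_right_gt.
have x1 : x < 1 by near: x; exact: nbhs_right_lt.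
have xe : x < eps ^+ 2 / 4 by near: x; apply: nbhs_right_lt; rewrite divr_gt0// exprn_gt0.
have s0 : 0 < Num.sqrt x by rewrite sqrtr_gt0.
have se : Num.sqrt x <= eps / 2.
  rewrite -(@ler_sqr _ (Num.sqrt x)) ?nnegrE//; try lra.
  by rewrite sqr_sqrtr ?ltW// exprMn; lra.
have xE : x = Num.sqrt x ^+ 2 by rewrite sqr_sqrtr// ltW.
have sV : ln (Num.sqrt x)^-1 < (Num.sqrt x)^-1 by apply: ln_sublinear; rewrite invr_gt0.
rewrite lnV ?posrE// in sV.
have l0 : ln (Num.sqrt x) <= 0.
  by rewrite ln_le0// -sqrtr1 ler_sqrt// ltW.
rewrite sub0r normrN normrM [X in ln X]xE lnXn// gtr0_norm// ler0_norm; last first.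
  by rewrite mulr2n; lra.
rewrite {1}xE; move: se s0 sV l0; move: (Num.sqrt x) => s se s0 sV l0.
have h : s * (- ln s) <= 1 by rewrite -(mulfV (lt0r_neq0 s0)) ler_pM2l// ltW.
rewrite mulr2n; nra.
Unshelve. all: by end_near. Qed.

Lemma lambdaT_cvg1 (R : realType) (d : nat) : (2 <= d)%N ->
  lambdaT d q @[q --> (1 : R)^'-] --> (lambdaT d 1 : R).
Proof.
move=> d2; have dR : 2 <= d%:R :> R by rewrite (ler_nat _ 2).
rewrite /lambdaT; apply: cvgM; first exact: cvg_cst.
apply: cvgB.
  apply: cvg_at_left_filter; apply: cvgD; apply: cvgM.
  - exact: cvg_id.
  - apply: (@cvg_comp _ _ _ (fun q : R => d%:R / q) (@ln R) _ (nbhs (d%:R / (1 : R)))).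
      by apply: cvgM; [exact: cvg_cst|apply: cvgV; [|exact: cvg_id]].
    by apply: continuous_ln; rewrite divr1; lra.
  - by apply: cvgB; [exact: cvg_cst|exact: cvg_id].
  - apply: (@cvg_comp _ _ _ (fun q : R => 1 - q / d%:R) (@ln R) _ (nbhs (1 - 1 / d%:R : R))).
      by apply: cvgB; [exact: cvg_cst|apply: cvgM; [exact: cvg_id|exact: cvg_cst]].
    apply: continuous_ln; rewrite subr_gt0 ltr_pdivrMr; lra.
(* The remaining term is the singular one: its value at 1 is 0, and its limit is that of [x ln x] at
   0 from the right. *)
rewrite subrr mulr0 mul0r.
have -> : (fun q : R => 2 * (1 - q) * ln (1 - q)) =
    (fun q => 2 * ((fun x => x * ln x) (1 - q))) by apply/funext => q; rewrite mulrA.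
rewrite -[X in _ --> X](mulr0 2); apply: cvgM; first exact: cvg_cst.
apply: (@cvg_comp _ _ _ (fun q : R => 1 - q) (fun x => x * ln x) _ (0 : R)^'+).
  move=> P [e /= e0 he]; exists e => //= q /= hq q1.
  apply: he => /=; last by rewrite subr_gt0.
  by move: hq; rewrite sub0r normrN.
exact: cvg_xlnx_0.
Qed.

(** * The matching measure *)

(** The difference vanishes at the integers 1, 2, ..., and enough of them are listed to exceed its
    degree. *)
Lemma poly_eq_pos (R : numDomainType) (p q : {poly R}) :
  (forall u, 0 < u -> p.[u] = q.[u]) -> p = q.
Proof.
move=> h; apply/eqP; rewrite -subr_eq0; apply/eqP.
apply: (@roots_geq_poly_eq0 _ (p - q) [seq k.+1%:R | k <- iota 0 (size (p - q)).+1]).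
- apply/allP => x /mapP[k _ ->]; by rewrite /root !hornerE h ?ltr0Sn// subrr.
- rewrite map_inj_uniq ?iota_uniq// => a b /eqP; rewrite eqr_nat => /eqP [].
  by [].
- by rewrite size_map size_iota.
Qed.

Lemma ln_prod (R : realType) (I : Type) (r : seq I) (F : I -> R) :
  (forall i, 0 < F i) -> ln (\prod_(i <- r) F i) = \sum_(i <- r) ln (F i).
Proof.
move=> F0; elim: r => [|a r IH]; first by rewrite !big_nil ln1.
by rewrite !big_cons lnM ?posrE ?prodr_gt0// IH.
Qed.

Section MatchingRoots.
Import boot.fintype boot.finset.
Variables (R : realType) (G : graph).
Local Notation V := 'I_(gv G).
Implicit Types (t u x y : R) (W : {set V}).

Lemma mupoly_horner x : (mupoly R G).[x] =
  \sum_(M : {set {set V}} | is_matching M) (-1) ^+ #|M| * x ^+ (gv G - 2 * #|M|).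
Proof.
rewrite -(sum_mk G (fun k => (-1) ^+ k * x ^+ (gv G - 2 * k))) /mupoly horner_sum.
by apply: eq_bigr => k _; rewrite hornerZ hornerXn mulrCA mulrA.
Qed.

Lemma mupoly_Mpoly y : y != 0 ->
  (Mpoly R G).[- y ^+ 2] = y ^+ gv G * (mupoly R G).[y^-1].
Proof.
move=> y0; rewrite Mpoly_sum mupoly_horner mulr_sumr; apply: eq_bigr => M mM.
have key n k : (2 * k <= n)%N -> (- y ^+ 2) ^+ k = y ^+ n * ((-1) ^+ k * y^-1 ^+ (n - 2 * k)).
  move=> kn; rewrite -{1}(subnK kn) exprD [LHS]exprNn -exprM exprVn [RHS]mulrCA; congr (_ * _).
  by rewrite mulrAC divff ?mul1r// expf_neq0.
exact/key/matching_size.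
Qed.

Lemma mk0 : mk G 0 = 1%N.
Proof.
rewrite /mk -(cards1 (set0 : {set {set V}})); apply: eq_card => M.
rewrite !inE cards_eq0; case: eqP => [->|_]; last by rewrite andbF.
by rewrite is_matching0.
Qed.

Lemma size_mupoly : (0 < gv G)%N -> size (mupoly R G) = (gv G).+1.
Proof.
move=> v0; rewrite /mupoly big_ord_recl /= mk0 expr0 mul1r scale1r muln0 subn0.
rewrite size_polyDl size_polyXn// ltnS.
apply: leq_trans (size_sum _ _ _) _; apply/bigmax_leqP => k _.
(* Even where the natural subtraction truncates, the exponent stays below [gv G], because [gv G] is
   positive. *)
apply: leq_trans (size_scale_leq _ _) _; rewrite size_polyXn /bump /=; lia.
Qed.

Lemma Zm_empty t : Zm (set0 : {set V}) t = 1.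
Proof.
rewrite /Zm (big_pred1 (set0 : {set {set V}})) ?cards0 ?expr0// => M /=.
apply/andP/eqP => [[mM c0]|->]; last by rewrite is_matching0 /cover big_set0 sub0set.
have := matching_card_cover mM; move: c0; rewrite subset0 => /eqP ->.
by rewrite cards0 => /esym/eqP; rewrite muln_eq0 /= cards_eq0 => /eqP.
Qed.

Variable d : nat.
Hypothesis regG : regular d G.

(** Strong induction on [#|W|]: by the factor 2 for [W :\ v], the negative part of the recursion is
    at most [2 d u <= 1 / 2] times [Zm (W :\ v) (- u)], so at least half of the latter remains. *)
Lemma Zm_neg_gt0 u W : 0 <= u -> 4 * d%:R * u <= 1 ->
  0 < Zm W (- u) /\ forall v, v \in W -> Zm (W :\ v) (- u) <= 2 * Zm W (- u).
Proof.
move=> u0 ud; have [n] := ubnP #|W|; elim: n W => // n IH W; rewrite ltnS => Wn.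
have step v : v \in W -> 0 < Zm (W :\ v) (- u) /\ Zm (W :\ v) (- u) <= 2 * Zm W (- u).
  move=> vW; have Wv : (#|W :\ v| < n)%N by move: Wn; rewrite (cardsD1 v) vW add1n.
  have [Z0 Zle] := IH _ Wv; split => //.
  rewrite (Zm_rec (- u) vW) mulNr.
  have : \sum_(w in W :\ v | @gadj G v w) Zm (W :\ v :\ w) (- u) <=
         d%:R * (2 * Zm (W :\ v) (- u)).
    rewrite -(sum_neighbours regG _ v) big_mkcond [leRHS]big_mkcond /=.
    apply: ler_sum => w _; rewrite [w \in [set: V] :\ v]in_setD1 in_setT andbT.
    case: (boolP (w \in W :\ v)) => [wW|_] /=.
      by move: (wW); rewrite in_setD1 => /andP[-> _] /=; case: ifP => // _; exact: Zle.
    by case: ifP => // _; rewrite mulr_ge0// ltW.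
  set S := \sum_(w in _ | _) _ => hS.
  have : u * S <= u * (d%:R * (2 * Zm (W :\ v) (- u))) by rewrite ler_wpM2l.
  have : (4 * d%:R * u) * Zm (W :\ v) (- u) <= 1 * Zm (W :\ v) (- u).
    by rewrite ler_wpM2r// ltW.
  rewrite mul1r (_ : u * (d%:R * (2 * Zm (W :\ v) (- u))) =
     (4 * d%:R * u * Zm (W :\ v) (- u)) / 2); last by field.
  by move: (4 * d%:R * u * Zm (W :\ v) (- u)) (u * S) => a b h1 h2; lra.
split; last by move=> v /step[].
have [->|[v /step[h1 h2]]] := set_0Vmem W; first by rewrite Zm_empty.
lra.
Qed.

Variable s : seq R.
Hypothesis vG : (0 < gv G)%N.
Hypothesis sP : mupoly R G = \prod_(z <- s) ('X - z%:P).

Lemma size_roots : size s = gv G.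
Proof. by apply: succn_inj; rewrite -(size_mupoly vG) sP size_prod_XsubC. Qed.

Lemma Mpoly_prod_roots y : y != 0 -> (Mpoly R G).[- y ^+ 2] = \prod_(z <- s) (1 - y * z).
Proof.
move=> y0; rewrite mupoly_Mpoly// sP horner_prod -size_roots.
elim: s => [|z r IH]; first by rewrite !big_nil mulr1.
rewrite !big_cons /= exprS hornerXsubC; set Q := \prod_(j <- r) _ in IH *.
by rewrite -IH -[in RHS](mulfV y0); ring.
Qed.

(** For [u = y^2 > 0], the value at [- u] is the product of the [1 - y z] and, with [- y] for [y],
    also that of the [1 + y z]; so no pairing of the zeros is needed. The product of both is a
    polynomial identity in [u > 0], which carries over to every [t]. *)
Lemma Mpoly_sqr_prod_roots t : (Mpoly R G).[t] ^+ 2 = \prod_(z <- s) (1 + t * z ^+ 2).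
Proof.
pose B : {poly R} := \prod_(z <- s) (1 - (z ^+ 2) *: 'X).
pose A : {poly R} := (Mpoly R G \Po (- 'X)) ^+ 2.
have AE u : A.[u] = (Mpoly R G).[- u] ^+ 2 by rewrite /A horner_exp horner_comp !hornerE.
have BE u : B.[u] = \prod_(z <- s) (1 - z ^+ 2 * u).
  by rewrite /B horner_prod; apply: eq_bigr => z _; rewrite !hornerE.
have AB : A = B.
  apply: poly_eq_pos => u u0; rewrite AE BE.
  have q0 : Num.sqrt u != 0 by rewrite gt_eqF// sqrtr_gt0.
  have uE : u = Num.sqrt u ^+ 2 by rewrite sqr_sqrtr// ltW.
  have e1 := Mpoly_prod_roots q0; rewrite -uE in e1.
  have q0' : - Num.sqrt u != 0 by rewrite oppr_eq0.
  have e2 := Mpoly_prod_roots q0'; rewrite sqrrN -uE in e2.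
  rewrite expr2 {1}e1 e2 -big_split /=; apply: eq_bigr => z _.
  by rewrite [in RHS]uE; ring.
have := AE (- t); rewrite AB BE opprK => <-.
by apply: eq_bigr => z _; ring.
Qed.

(** Otherwise [u = 1 / z^2] satisfies [4 d u <= 1], so [Mpoly] is positive at [- u], while the
    factor of [z] in the product vanishes. *)
Lemma roots_bound z : z \in s -> z ^+ 2 <= 4 * d%:R.
Proof.
move=> zs; rewrite leNgt; apply/negP => hz.
have z2 : 0 < z ^+ 2 by apply: le_lt_trans hz; rewrite mulr_ge0.
have u0 : 0 <= (z ^+ 2)^-1 by rewrite invr_ge0 ltW.
have ud : 4 * d%:R * (z ^+ 2)^-1 <= 1 by rewrite ler_pdivrMr// mul1r ltW.
have [+ _] := @Zm_neg_gt0 _ [set: V] u0 ud.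
rewrite -Mpoly_horner => M0.
have := Mpoly_sqr_prod_roots (- (z ^+ 2)^-1).
rewrite (big_rem z)//= mulNr mulVf ?gt_eqF// subrr mul0r => /eqP.
by rewrite expf_eq0 /= gt_eqF.
Qed.

Lemma sum_ln_roots t : 0 <= t ->
  \sum_(z <- s) 2^-1 * ln (1 + t * z ^+ 2) = ln (Mpoly R G).[t].
Proof.
move=> t0; rewrite -mulr_sumr -ln_prod; last first.
  by move=> z; rewrite ltr_pwDl// mulr_ge0// sqr_ge0.
by rewrite -Mpoly_sqr_prod_roots lnXn ?Mpoly_gt0// mulr2n; field.
Qed.

End MatchingRoots.

(** Without a factorization [mroots] would be the default [[::]], and the integral of 1 would be
    0. *)
Lemma mroots_split (R : realType) (G : graph) :
  rho_int G (fun=> 1 : R) != 0 -> mupoly R G = \prod_(z <- mroots R G) ('X - z%:P).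
Proof.
rewrite /rho_int /mroots; case: xgetP => [s -> //|_].
by rewrite big_nil mul0r eqxx.
Qed.

(** * The weak limit of the matching measures *)

Section WeakLimit.
Variables (R : realType) (d : nat) (Gs : nat -> graph) (rho : probability R R).
Hypothesis d2 : (2 <= d)%N.
Hypothesis vGs : forall i, (0 < gv (Gs i))%N.
Hypothesis regGs : forall i, regular d (Gs i).
Hypothesis girthGs : girth_to_infty Gs.
Hypothesis weakGs : weak_limit Gs rho.
Implicit Types (t z : R).

(* Real-rootedness need not be proved: testing the weak limit against the
   constant [1] rules out the junk value [::] of [mroots]. *)
Lemma near_mupoly_split : \forall i \near \oo,
  mupoly R (Gs i) = \prod_(z <- mroots R (Gs i)) ('X - z%:P).
Proof.
have c1 : continuous (fun _ : R => 1 : R) by move=> x; exact: cvg_cst.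
have b1 : exists M : R, forall x : R, `|1 : R| <= M by exists 1 => _; rewrite normr1.
have int1 : (\int[rho]_x (1 : R)%:E)%E = 1%E by rewrite integral_cst// mul1e; exact: probability_setT.
have := weakGs c1 b1; rewrite int1.
move=> /fine_cvgP[_] /cvgrPdist_lt/(_ _ ltr01) /= h.
apply: filterS h => i /= h; apply: mroots_split; apply/eqP => h0.
by move: h; rewrite h0 subr0 normr1 ltxx.
Qed.

Lemma near_mroots_bound : \forall i \near \oo,
  forall z, z \in mroots R (Gs i) -> z ^+ 2 <= 4 * d%:R.
Proof.
apply: filterS near_mupoly_split => i sP z.
exact: (roots_bound (@regGs i) (vGs i) sP).
Qed.

Lemma near_rho_int_ln t : 0 <= t -> \forall i \near \oo,
  rho_int (Gs i) (fun z => 2^-1 * ln (1 + t * z ^+ 2)) =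
  ln (Mpoly R (Gs i)).[t] / (gv (Gs i))%:R.
Proof.
move=> t0; apply: filterS near_mupoly_split => i sP.
by rewrite /rho_int (sum_ln_roots (vGs i) sP).
Qed.

Lemma integral_eq_of_near (f : R -> R) (u : nat -> R) (l : R) :
  continuous f -> (exists M : R, forall x, `|f x| <= M) ->
  (\forall i \near \oo, rho_int (Gs i) f = u i) -> u i @[i --> \oo] --> l ->
  (\int[rho]_x (f x)%:E)%E = l%:E.
Proof.
move=> cf bf nf ul; have := weakGs cf bf.
have h : (rho_int (Gs i) f)%:E @[i --> \oo] --> l%:E.
  apply: cvg_EFin; first exact: nearW.
  by apply: cvg_trans ul; apply: near_eq_cvg; apply: filterS nf => i /= e; rewrite -?e ?e.
by move=> h'; apply/esym; apply: cvg_unique h h'; exact: ereal_hausdorff.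
Qed.

Lemma continuous_sqr : continuous (fun z : R => z ^+ 2).
Proof. by move=> z; exact: exprn_continuous. Qed.

(** A bounded continuous test function that is positive exactly where [z ^+ 2 > 4 * d%:R]. *)
Let g z : R := Num.min 1 (Num.max 0 (z ^+ 2 - 4 * d%:R)).

Let g_continuous : continuous g.
Proof.
move=> z; apply: (@continuous_min R R (fun=> 1)
  (fun z => Num.max 0 (z ^+ 2 - 4 * d%:R)) z); first exact: cvg_cst.
apply: (@continuous_max R R (fun=> 0) (fun z => z ^+ 2 - 4 * d%:R) z); first exact: cvg_cst.
by apply: cvgB; [exact: continuous_sqr|exact: cvg_cst].
Qed.

Let g_ge0 z : 0 <= g z. Proof. by rewrite le_min ler01 le_max lexx. Qed.

(** For large [i] the function [g] vanishes at all zeros, so its integral against [rho] is 0; being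
    nonnegative, it vanishes almost everywhere. *)
Lemma rho_ae_bound : {ae rho, forall z, z ^+ 2 <= 4 * d%:R}.
Proof.
have mg : measurable_fun setT g by exact: continuous_measurable_fun.
have g0 : (\int[rho]_x (g x)%:E)%E = 0%:E.
  apply: (@integral_eq_of_near _ (fun=> 0)) => //.
  - exists 1 => x; rewrite ger0_norm//; by rewrite ge_min lexx.
  - apply: filterS near_mroots_bound => i hi; rewrite /rho_int big1_seq ?mul0r// => z.
    move=> /andP[_ zs]; rewrite /g max_l; first by rewrite min_r.
    by rewrite subr_le0 hi.
  - exact: cvg_cst.
have mgE : measurable_fun setT (EFin \o g) by exact/measurable_EFinP.
have [h _] := ae_eq_integral_abs rho measurableT mgE.
have /h : (\int[rho]_x `|(EFin \o g) x|)%E = 0%E.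
  by rewrite -[RHS]g0; apply: eq_integral => x _ /=; rewrite ger0_norm.
apply: filterS => z /(_ I) /= [] gz; rewrite leNgt; apply/negP => hz.
have : 0 < g z by rewrite lt_min ltr01 lt_max subr_gt0 hz orbT.
by rewrite gz ltxx.
Qed.

(** The integrand is unbounded and thus no test function. Its truncation [fB] is one, and agrees
    with it at the zeros for large [i] and almost everywhere for [rho]. *)
Lemma integral_ln_rho t : 0 < t ->
  (\int[rho]_z (2^-1 * ln (1 + t * z ^+ 2))%:E)%E = (Flim d (etar d t))%:E.
Proof.
move=> t0; pose f z := 2^-1 * ln (1 + t * z ^+ 2).
pose fB z := 2^-1 * ln (1 + t * Num.min (z ^+ 2) (4 * d%:R)).
have B0 : 0 <= 4 * d%:R :> R by rewrite mulr_ge0.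
have ln_cont (h : R -> R) : (forall z, 0 <= h z) -> continuous h ->
    continuous (fun z => 2^-1 * ln (1 + t * h z)).
  move=> h0 ch z; apply: cvgM; first exact: cvg_cst.
  apply: (@cvg_comp _ _ _ (fun z => 1 + t * h z) (@ln R) _ (nbhs (1 + t * h z))).
    by apply: cvgD; [exact: cvg_cst|apply: cvgM; [exact: cvg_cst|exact: ch]].
  by apply: continuous_ln; rewrite ltr_pwDl// mulr_ge0// ltW.
have min0 z : 0 <= Num.min (z ^+ 2) (4 * d%:R) by rewrite le_min sqr_ge0.
have cf : continuous f by apply: ln_cont; [move=> z; exact: sqr_ge0|exact: continuous_sqr].
have cfB : continuous fB.
  apply: ln_cont => // z.
  apply: (@continuous_min R R (fun z => z ^+ 2) (fun=> 4 * d%:R) z).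
    exact: continuous_sqr.
  exact: cvg_cst.
have ge0 (x : R) : 0 <= x -> 0 <= 2^-1 * ln (1 + t * x).
  by move=> x0; rewrite mulr_ge0// ln_ge0// lerDl mulr_ge0// ltW.
have mE (h : R -> R) : continuous h -> measurable_fun setT (EFin \o h).
  by move=> ch; apply/measurable_EFinP; exact: continuous_measurable_fun.
transitivity (\int[rho]_z (fB z)%:E)%E.
  apply: (@ge0_ae_eq_integral _ _ _ rho setT (EFin \o f) (EFin \o fB)) => //.
  - exact: mE.
  - exact: mE.
  - by move=> x _; rewrite lee_fin ge0// sqr_ge0.
  - by move=> x _; rewrite lee_fin ge0.
  - by apply: filterS rho_ae_bound => z hz _; rewrite /= /f /fB min_l.
apply: (integral_eq_of_near cfB _ _ (ln_Mpoly_cvg d2 vGs regGs girthGs (ltW t0))).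
  exists (2^-1 * ln (1 + t * (4 * d%:R))) => x; rewrite ger0_norm ?ge0//.
  rewrite ler_pM2l// ler_ln ?posrE ?ltr_pwDl ?mulr_ge0 ?(ltW t0)//.
  by rewrite lerD2l ler_pM2l// ge_min lexx orbT.
have nb := near_mroots_bound; have nr := near_rho_int_ln (ltW t0).
near=> i; transitivity (rho_int (Gs i) f); last by near: i; exact: nr.
have bd : forall z, z \in mroots R (Gs i) -> z ^+ 2 <= 4 * d%:R by near: i; exact: nb.
by rewrite /rho_int; congr (_ / _); apply: eq_big_seq => z /bd hz; rewrite /f /fB min_l.
Unshelve. all: by end_near. Qed.

End WeakLimit.

(** The value at [p = 1] in (d) is by definition a left limit, so (d) splits into the limits for
    [p < 1] and the left limit of [lambdaT d] at 1. *)
Theorem theorem2p15 (R : realType) (d : nat) (Gs : nat -> graph) :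
  (2 <= d)%N ->
  (forall i, 0 < gv (Gs i))%N ->
  (forall i, regular d (Gs i)) ->
  (forall i, bipartite (Gs i)) ->
  girth_to_infty Gs ->
  (* (a) *)
  (forall t : R, 0 <= t ->
     pG (Gs i) t @[i --> \oo] -->
       (2 * d%:R ^+ 2 * t + d%:R - d%:R * Num.sqrt (1 + 4 * (d%:R - 1) * t))
       / (2 * d%:R ^+ 2 * t + 2)) /\
  (* (b) *)
  (forall (t : R) (rho : probability R R), 0 < t -> weak_limit Gs rho ->
     (\int[rho]_z (2^-1 * ln (1 + t * z ^+ 2))%:E)%E = (2^-1 * ln (Sd d t))%:E) /\
  (* (c) *)
  (forall p : R, 0 <= p < 1 ->
     tG (Gs i) p @[i --> \oo] --> p * (d%:R - p) / (d%:R ^+ 2 * (1 - p) ^+ 2)) /\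
  (* (d) *)
  (forall p : R, 0 <= p < 1 -> lambdaG (Gs i) p @[i --> \oo] --> lambdaT d p) /\
  lambdaT d q @[q --> (1 : R)^'-] --> lambdaT d 1.
Proof.
move=> d2 vGs regGs _ girthGs; split.
  by move=> t t0; rewrite -(Plim_closed d2 t0); exact: pG_cvg.
split.
  by move=> t rho t0 wl; rewrite -(Flim_Sd d2 t0); exact: (integral_ln_rho d2 vGs).
split; first by move=> p p01; exact: (tG_cvg d2 vGs).
split; first by move=> p p01; exact: lambdaG_cvg.
exact: lambdaT_cvg1.
Qed.
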